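(* Let $\mathcal{C}$ be a class of polytime computable functions from $\mathbb{R}^2$ to $\mathbb{R}$ that approximates the class of polytime computable integer functions. Let $f:\mathbb{R}\to\mathbb{R}$ be Lipschitz. Then $f$ is polytime computable if and only if $f$ is $\mathcal{C}$-definable.
   Context: Dyadic numbers: $\mathbb{D}=\{a/2^b : a\in\mathbb{Z}, b\in\mathbb{N}\}$. For $x\in\mathbb{R}$, $CF_x$ is the set of functions $\varphi:\mathbb{N}\to\mathbb{D}$ with $|x-\varphi(n)|\le 2^{-n}$ for all $n\in\mathbb{N}$. A function $f:\mathbb{R}^d\to\mathbb{R}$ is computable if there is an oracle Turing machine $M$ (with $d$ oracles) such that for all $(x_1,\dots,x_d)\in\mathbb{R}^d$, all $\varphi_i\in CF_{x_i}$ and all $n\in\mathbb{N}$, $|M^{\varphi_1,\dots,\varphi_d}(n)-f(x_1,\dots,x_d)|\le 2^{-n}$. It is polytime computable if moreover there is a polynomial $p$ such that the running time of $M^{\varphi_1,\dots,\varphi_d}(n)$ is at most $p(k,n)$, where $k=\min\{j\in\mathbb{N} : x_1,\dots,x_d\in[-2^j,2^j]\}$. An integer function $h:\mathbb{Z}^2\to\mathbb{Z}$ is polytime computable if it is computable by a Turing machine in time polynomial in the lengths of the binary representations of its arguments. $f$ is Lipschitz if there is a constant $K\ge 0$ with $|f(x_1)-f(x_2)|\le K|x_1-x_2|$ for all $x_1,x_2\in\mathbb{R}$. A class $\mathcal{C}$ of functions $\mathbb{R}^2\to\mathbb{R}$ approximates a class $\mathcal{D}$ of functions $\mathbb{Z}^2\to\mathbb{Z}$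 if for every $g\in\mathcal{D}$ there is $\tilde g\in\mathcal{C}$ with $|\tilde g(x,y)-g(x,y)|\le 1/4$ for all $x,y\in\mathbb{Z}$. Here $\mathcal{D}$ is the class of polytime computable functions $\mathbb{Z}^2\to\mathbb{Z}$. $f:\mathbb{R}\to\mathbb{R}$ is $\mathcal{C}$-definable if there is $\tilde g\in\mathcal{C}$ such that $|\tilde g(x,y)-y f(x/y)|\le 3$ for all $x\in\mathbb{Z}$ and all integers $y\ge 1$. *)

(* Defs.v *)
From HB Require Import structures.
From mathcomp Require Import all_boot all_order all_algebra.
From mathcomp Require Import polyXY.
From mathcomp Require Import classical_sets reals normedtype.

Set Implicit Arguments.
Unset Strict Implicit.
Unset Printing Implicit Defensive.

Import Order.TTheory GRing.Theory Num.Theory.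
Import numFieldNormedType.Exports.

Local Open Scope classical_set_scope.
Local Open Scope ring_scope.

Inductive sym := Zero | One | Minus | Point | Comma.

Definition sym_code (a : sym) : 'I_5 :=
  inord (match a with
         | Zero => 0 | One => 1 | Minus => 2 | Point => 3 | Comma => 4
         end).

Definition sym_decode (i : 'I_5) : sym := nth Zero [:: Zero; One; Minus; Point; Comma] i.

Lemma sym_codeK : cancel sym_code sym_decode.
Proof. by case; rewrite /sym_code /sym_decode inordK. Qed.

HB.instance Definition _ := Finite.copy sym (can_type sym_codeK).

(* The [b] low-order binary digits of [m], most significant first. *)
Definition digits (m b : nat) : seq sym :=
  mkseq (fun i => if odd (m %/ 2 ^ (b - i.+1))%N then One else Zero) b.

(* Binary numeral without leading zeros; 0 is written "0". *)
Definition bin (m : nat) : seq sym := digits m (trunc_log 2 m).+1.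

Definition enc_int (z : int) : seq sym :=
  nseq (z < 0)%R Minus ++ bin `|z|%N.

Definition dyadic (q : rat) : Prop :=
  exists (a : int) (b : nat), q = a%:~R / 2 ^+ b.

(* Positional notation [-]u_1...u_r.v_1...v_s of a dyadic number, most
   significant digit first, with neither superfluous leading nor trailing
   zeros: in lowest terms the denominator is 2 ^ s.  Only meaningful on dyadic
   arguments. *)
Definition enc_dyadic (q : rat) : seq sym :=
  let a := `|numq q|%N in
  let b := `|denq q|%N in
  nseq (q < 0)%R Minus ++ bin (a %/ b)%N ++ Point :: digits a (logn 2 b).

Inductive dir := Left | Stay | Right.

(* [None] is the blank; besides the symbols of [sym] a machine may use a finite
   auxiliary alphabet. *)
Definition cell (aux : finType) : Type := option (sym + aux).

(* [delta] is applied to the current state and the scanned symbols, and gives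
   the new state and, for every tape, the symbol written and the head move.
   If [query q = Some (i, q')], the machine in state [q] consults its [i]-th
   oracle and proceeds to state [q'].  With [d = 0] this is an ordinary
   deterministic multitape Turing machine. *)
Record otm (d : nat) := OTM {
  state : finType;
  tape : finType;
  aux : finType;
  input : tape;
  output : tape;
  question : tape;
  answer : tape;
  tapes_uniq : uniq [:: input; output; question; answer];
  start : state;
  final : pred state;
  query : state -> option ('I_d * state);
  delta : state -> {ffun tape -> cell aux} -> state * {ffun tape -> cell aux * dir}
}.

(* Tapes are infinite to the right; cells beyond [cells] are blank.  A head that
   is asked to move left on cell 0 does not move. *)
Record tape_content (aux : finType) := Tape { cells : seq (cell aux); head : nat }.

Section Tapes.
Variable aux : finType.
Implicit Types (s : seq (cell aux)) (t : tape_content aux).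

Definition read t : cell aux := nth None (cells t) (head t).

Definition write (a : cell aux) t : tape_content aux :=
  Tape (set_nth None (cells t) (head t) a) (head t).

Definition move (m : dir) t : tape_content aux :=
  Tape (cells t)
    (match m with Left => (head t).-1 | Stay => head t | Right => (head t).+1 end).

Definition load (w : seq sym) : tape_content aux :=
  Tape [seq Some (inl a) | a <- w] 0.

Fixpoint word_of s : seq (sym + aux) :=
  if s is Some a :: s' then a :: word_of s' else [::].

(* The word from cell 0 up to the first blank. *)
Definition word t : seq (sym + aux) := word_of (cells t).

End Tapes.

Section Runs.
Variables (d : nat) (M : otm d) (phi : 'I_d -> nat -> rat).

Record config := Config {
  current : state M;
  contents : {ffun tape M -> tape_content (aux M)}
}.

(* An oracle call takes one step: the number queried, in unary, is the length of
   the word on the question tape, and the answer replaces the whole content of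
   the answer tape.  Final configurations do not change, so being final after t
   steps means having a running time of at most t. *)
Definition step (c : config) : config :=
  if final (current c) then c else
  match query (current c) with
  | Some (i, q) =>
      let m := size (word (contents c (question M))) in
      Config q [ffun t => if t == answer M then load (aux M) (enc_dyadic (phi i m))
                          else contents c t]
  | None =>
      let: (q, act) := delta (current c) [ffun t => read (contents c t)] in
      Config q [ffun t => move (act t).2 (write (act t).1 (contents c t))]
  end.

Definition init (w : seq sym) : config :=
  Config (start M) [ffun t => load (aux M) (if t == input M then w else [::])].

Definition run (w : seq sym) (t : nat) : config := iter t step (init w).

Definition halted (c : config) : bool := final (current c).

Definition outputs (c : config) (w : seq sym) : Prop :=
  word (contents c (output M)) = [seq inl a | a <- w].

End Runs.

Definition no_oracle : 'I_0 -> nat -> rat := fun _ _ => 0.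

Definition int_input (x y : int) : seq sym := enc_int x ++ Comma :: enc_int y.

Definition int_computes (M : otm 0) (h : int -> int -> int) : Prop :=
  forall x y : int, exists t : nat,
    let c := run M no_oracle (int_input x y) t in
    halted c /\ outputs c (enc_int (h x y)).

Definition polytime_int (h : int -> int -> int) : Prop :=
  exists2 M : otm 0, int_computes M h &
  exists p : {poly {poly nat}}, forall x y : int,
    halted (run M no_oracle (int_input x y)
              p.[size (enc_int x), size (enc_int y)]).

Section RealFunctions.
Variable R : realType.

Definition CF (x : R) : set (nat -> rat) :=
  [set phi | forall n, dyadic (phi n) /\ `|x - ratr (phi n)| <= 2 ^- n].

Definition real_computes d (M : otm d) (f : ('I_d -> R) -> R) : Prop :=
  forall (x : 'I_d -> R) (phi : 'I_d -> nat -> rat),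
    (forall i, CF (x i) (phi i)) ->
  forall n : nat, exists t : nat,
    let c := run M phi (nseq n One) t in
    halted c /\
    exists q : rat,
      [/\ dyadic q, outputs c (enc_dyadic q) & `|ratr q - f x| <= 2 ^- n].

Lemma magnitude_ex d (x : 'I_d -> R) :
  exists j : nat, [forall i, - 2 ^+ j <= x i <= 2 ^+ j].
Proof.
exists (\max_i Num.bound `|x i|); apply/forallP => i; rewrite -ler_norml.
apply/ltW/(lt_le_trans (archi_boundP (normr_ge0 (x i)))).
rewrite -natrX ler_nat; apply: leq_trans (ltnW (ltn_expl _ (ltnSn 1))) _.
by rewrite leq_exp2l //; exact: (leq_bigmax (F := fun i => Num.bound `|x i|)).
Qed.

(* The least [j] such that all [x i] lie in [- 2 ^ j, 2 ^ j]. *)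
Definition magnitude d (x : 'I_d -> R) : nat := ex_minn (magnitude_ex x).

Definition polytime_real d (f : ('I_d -> R) -> R) : Prop :=
  exists2 M : otm d, real_computes M f &
  exists p : {poly {poly nat}},
  forall (x : 'I_d -> R) (phi : 'I_d -> nat -> rat),
    (forall i, CF (x i) (phi i)) ->
  forall n : nat, halted (run M phi (nseq n One) p.[magnitude x, n]).

Definition polytime_real1 (f : R -> R) : Prop :=
  polytime_real (fun x : 'I_1 -> R => f (x ord0)).

Definition polytime_real2 (g : R -> R -> R) : Prop :=
  polytime_real (fun x : 'I_2 -> R => g (x ord0) (x ord_max)).

Definition approximates (C : set (R -> R -> R)) (D : set (int -> int -> int)) : Prop :=
  forall h, D h -> exists2 g, C g &
  forall x y : int, `|g x%:~R y%:~R - (h x y)%:~R| <= 1 / 4.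

Definition definable (C : set (R -> R -> R)) (f : R -> R) : Prop :=
  exists2 g, C g &
  forall x y : int, 1 <= y ->
    `|g x%:~R y%:~R - y%:~R * f (x%:~R / y%:~R)| <= 3.

End RealFunctions.

(* Main.v *)
Require Import Defs.
From HB Require Import structures.
From mathcomp Require Import all_boot all_order all_algebra.
From mathcomp Require Import polyXY.
From mathcomp Require Import boolp classical_sets reals normedtype.
From mathcomp Require Import zify ring lra.
Import Order.TTheory GRing.Theory Num.Theory.
Import numFieldNormedType.Exports.
Local Open Scope classical_set_scope.
Local Open Scope ring_scope.

(* Both directions run the given machine on a constant oracle, so that an oracle
   call of that machine is simulated by copying a fixed word.

   If [f] is definable by [g], then to get [f x] up to [2 ^- n] take
   [y = 2 ^ (n + c)] and an integer [X] with [`|X / y - x| <= 2 / y], run the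
   machine of [g] with precision 1 on the exact arguments [X] and [y], and move
   the binary point of its (truncated) answer [n + c] places to the left; the
   error is at most [(5 + 2 K) / y], where [K] is the Lipschitz constant.

   If [f] is polytime computable, then [y * f (x / y)] is rounded to an integer
   by a machine that computes the first [size y + c] fractional digits [q] of
   [x / y] by long division, runs the machine of [f] on the dyadic number [q]
   with precision [size y], and multiplies the answer by [y]; the error is at
   most [1 + 1 + 1 / 2], and the approximation of this integer function by an
   element of [C] adds [1 / 4].

   The machines are built from one-entry one-exit fragments by sequencing,
   branching and looping; the time spent in a fragment is part of its
   specification. *)

Set Implicit Arguments.
Unset Strict Implicit.
Unset Printing Implicit Defensive.

Local Open Scope nat_scope.

(** * Machine fragments *)

(** A constant oracle is legitimate only at a dyadic argument, and this shapes both constructions.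
    Definability speaks about integer points, which are dyadic, so the machine of [g] can be run
    there without any input error. The quotient [x / y] is in general not dyadic; it has to be
    replaced by a nearby dyadic number, and the Lipschitz constant pays for that. In both cases [c]
    depends on [K] only and absorbs it: [5 + 2 * K <= 2 ^ c] turns the error at scale [2 ^ (n + c)]
    into [2 ^- n], and [2 * K <= 2 ^ c] makes the Lipschitz error at most [1 / 2]. Polynomial time
    survives because [magnitude] is bounded by the number of digits of the argument, and because a
    simulated step costs time linear in the space in use. The remaining obstacles are concrete. Only
    canonical numerals may be printed; a simulated tape has to be rewound and erased although a head
    senses neither the left end nor the end of what was written; and the machine for integers has to
    halt in time also for [y <= 0], where nothing is claimed about its result. *)

Section Tapes.
Variable aux : finType.

(* Tapes up to trailing blanks: the contents as a function, and the head. *)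
Definition atape : Type := (nat -> cell aux) * nat.

Definition abs (t : tape_content aux) : atape := (nth None (cells t), Defs.head t).

Definition aread (x : atape) : cell aux := x.1 x.2.

Definition ashift (m : dir) (h : nat) : nat :=
  match m with Left => h.-1 | Stay => h | Right => h.+1 end.

Definition astep (a : cell aux * dir) (x : atape) : atape :=
  (fun i => if i == x.2 then a.1 else x.1 i, ashift a.2 x.2).

Lemma abs_step a t : abs (move a.2 (write a.1 t)) = astep a (abs t).
Proof.
case: a => a m; rewrite /abs /astep /=; congr pair.
by apply/funext => i; rewrite nth_set_nth.
Qed.

Lemma astep_stay x : astep (aread x, Stay) x = x.
Proof.
case: x => f h; rewrite /astep /aread /=; congr pair.
by apply/funext => i; case: eqP => [->|].
Qed.

Definition blank : atape := (fun=> None, 0).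

Definition wordf (w : seq sym) : nat -> cell aux := nth None [seq Some (inl a) | a <- w].

Lemma wordfE w i : wordf w i = if i < size w then Some (inl (nth Zero w i)) else None.
Proof.
rewrite /wordf; case: ltnP => lt_i; first by rewrite (nth_map Zero).
by rewrite nth_default ?size_map.
Qed.

Lemma abs_load w : abs (load aux w) = (wordf w, 0).
Proof. by []. Qed.

Lemma word_abs t w : (abs t).1 = wordf w -> word t = [seq inl a | a <- w].
Proof.
rewrite /abs /word /=; elim: (cells t) w => [|a s IHs] [|b w] //=.
- by move=> /(congr1 (fun f => f 0)).
- by move=> /(congr1 (fun f => f 0)); rewrite /wordf /= => ->.
move=> eq_f; have := congr1 (fun f => f 0) eq_f; rewrite /wordf /= => ->.
congr cons; apply: IHs; apply/funext => i.
by have := congr1 (fun f => f i.+1) eq_f.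
Qed.

(** The output convention controls the cells up to and including the first blank only; whatever a
    machine leaves beyond is arbitrary. *)
Lemma abs_word t w : word t = [seq inl a | a <- w] ->
  forall i, i <= size w -> (abs t).1 i = wordf w i.
Proof.
rewrite /abs /word /=; elim: (cells t) w => [|[a|] s IHs] [|b w] //=.
  by move=> [-> /IHs {}IHs] [|i] // /IHs.
by move=> _ [].
Qed.

End Tapes.

(** * Program fragments and their composition rules with time bounds *)

Section Fragments.
Variables (d : nat) (T aux S : finType).

(* [S] is the type of the finite control, [P] that of continuations. *)
Inductive instr (P : Type) : Type :=
| Ask of 'I_d & P
| Act of (S -> {ffun T -> cell aux} -> P * S * {ffun T -> cell aux * dir}).

Definition imap P P' (f : P -> P') (c : instr P) : instr P' :=
  match c with
  | Ask i p => Ask i (f p)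
  | Act g => Act (fun s r => let: (p, s', a) := g s r in (f p, s', a))
  end.

(* The continuation [None] means that control leaves the fragment. *)
Record frag := Frag {
  point : finType;
  entry : point;
  code : point -> instr (option point)
}.

Definition stay (r : {ffun T -> cell aux}) : {ffun T -> cell aux * dir} :=
  [ffun t => (r t, Stay)].

Definition basic (f : S -> {ffun T -> cell aux} -> S * {ffun T -> cell aux * dir}) :=
  @Frag unit tt (fun=> Act (fun s r => (None, (f s r).1, (f s r).2))).

Definition consult (i : 'I_d) := @Frag unit tt (fun=> Ask i None).

Definition seqf (F G : frag) : frag :=
  @Frag (point F + point G)%type (inl (entry F)) (fun p => match p with
  | inl p => imap (fun o => Some (if o is Some q then inl q else inr (entry G))) (code p)
  | inr p => imap (fun o => if o is Some q then Some (inr q) else None) (code p)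
  end).

Definition condf (b : S -> bool) (F G : frag) : frag :=
  @Frag (option (point F + point G)) None (fun p => match p with
  | None => Act (fun s r =>
      (Some (Some (if b s then inl (entry F) else inr (entry G))), s, stay r))
  | Some (inl p) => imap (fun o => if o is Some q then Some (Some (inl q)) else None) (code p)
  | Some (inr p) => imap (fun o => if o is Some q then Some (Some (inr q)) else None) (code p)
  end).

(** [G] runs before every test, since a symbol has to be brought into the control before it can be
    tested. *)
Definition loopf (G : frag) (b : S -> bool) (F : frag) : frag :=
  @Frag (point G + option (point F))%type (inl (entry G)) (fun p => match p with
  | inl p => imap (fun o => Some (if o is Some q then inl q else inr None)) (code p)
  | inr None => Act (fun s r =>
      (if b s then Some (inr (Some (entry F))) else None, s, stay r))
  | inr (Some p) =>
      imap (fun o => Some (if o is Some q then inr (Some q) else inl (entry G))) (code p)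
  end).

Variables (tq tans : T) (phi : 'I_d -> nat -> rat).

Definition perform P (c : instr P) (s : S) (C : {ffun T -> tape_content aux}) :=
  match c with
  | Ask i p => (p, s, [ffun t => if t == tans
      then load aux (enc_dyadic (phi i (size (word (C tq))))) else C t])
  | Act f => let: (p, s', a) := f s [ffun t => read (C t)] in
      (p, s', [ffun t => move (a t).2 (write (a t).1 (C t))])
  end.

Lemma perform_imap P P' (f : P -> P') c s C :
  perform (imap f c) s C = let: (p, s', C') := perform c s C in (f p, s', C').
Proof. by case: c => [i p|g] //=; case: g => [[p s'] a]. Qed.

Inductive exits (F : frag) :
  option (point F) -> S -> {ffun T -> tape_content aux} -> nat ->
  S -> {ffun T -> tape_content aux} -> Prop :=
| exits_done s C : exits None s C 0 s C
| exits_step p s C o s1 C1 n s' C' : perform (code p) s C = (o, s1, C1) ->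
    exits o s1 C1 n s' C' -> exits (Some p) s C n.+1 s' C'.

(** The common core of sequencing, branching and looping: the code of [F] sits inside that of [G]
    along [e], with its exit redirected to [x], so a run of [F] is continued by any run from [x]. *)
Lemma exits_embed (F G : frag) (e : point F -> point G) (x : option (point G)) :
  (forall p, code (e p) = imap (fun o => if o is Some q then Some (e q) else x) (code p)) ->
  forall o s C n s' C' m s'' C'',
  exits o s C n s' C' -> exits x s' C' m s'' C'' ->
  exits (if o is Some p then Some (e p) else x) s C (n + m) s'' C''.
Proof.
move=> eG o s C n s' C' m s'' C''; elim=> //.
move=> p s0 C0 o' s1 C1 n0 s2 C2 E _ IH /IH {}IH.
by rewrite addSn; apply: exits_step IH; rewrite eG perform_imap E.
Qed.

Definition store : Type := T -> atape aux.

Definition represents (C : {ffun T -> tape_content aux}) (st : store) : Prop :=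
  forall t, abs (C t) = st t.

(** Total correctness with a time bound. Quantifying over every [C] that represents the store hides
    the trailing blanks of [cells], and [k <= n] allows bounds to be rounded up. *)
Variant runs (F : frag) (c : S * store) (n : nat) (c' : S * store) : Prop :=
  Runs of forall C, represents C c.2 -> exists k C',
  [/\ k <= n, exits (Some (entry F)) c.1 C k c'.1 C' & represents C' c'.2].

Lemma runs_le F c n n' c' : n <= n' -> runs F c n c' -> runs F c n' c'.
Proof.
move=> le_n [rF]; split=> C /rF[k [C' [le_k ex rC]]]; exists k, C'; split=> //.
exact: leq_trans le_n.
Qed.

Lemma runs_to F c n n' c' c'' : runs F c n c' -> n <= n' -> c' = c'' -> runs F c n' c''.
Proof. by move=> rF le_n <-; apply: runs_le rF. Qed.

Lemma represents_stay C st : represents C st ->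
  represents [ffun t => move (stay [ffun t => read (C t)] t).2
                (write (stay [ffun t => read (C t)] t).1 (C t))] st.
Proof. by move=> rC t; rewrite ffunE abs_step -rC /stay !ffunE; exact: astep_stay. Qed.

Lemma runs_basic f s st :
  let r := [ffun t => aread (st t)] in
  runs (basic f) (s, st) 1 ((f s r).1, fun t => astep ((f s r).2 t) (st t)).
Proof.
move=> r; split=> C rC.
have <- : [ffun t => read (C t)] = r by apply/ffunP => t; rewrite !ffunE -[st t]rC.
eexists 1, _; split=> //=; first by apply: exits_step; [reflexivity | exact: exits_done].
by move=> t; rewrite ffunE abs_step rC.
Qed.

Lemma runs_seq F G c c1 c2 n m :
  runs F c n c1 -> runs G c1 m c2 -> runs (seqf F G) c (n + m) c2.
Proof.
move=> [rF] [rG]; split=> C /rF[k [C1 [le_k ex1 /rG[k2 [C2 [le_k2 ex2 rC]]]]]].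
exists (k + k2), C2; split=> //; first exact: leq_add.
apply: (@exits_embed F (seqf F G) inl (Some (inr (entry G))) _ _ _ _ _ _ _ _ _ _ ex1).
  by move=> p /=; congr imap; apply/funext; case.
rewrite -[k2]addn0.
by apply: (@exits_embed G (seqf F G) inr None _ _ _ _ _ _ _ _ _ _ ex2 (exits_done _ _ _)).
Qed.

Lemma runs_cond (b : S -> bool) F G c n c' :
  runs (if b c.1 then F else G) c n c' -> runs (condf b F G) c n.+1 c'.
Proof.
move=> [rF]; split=> C rC; have [] := rF _ (represents_stay rC).
move=> k [C' [le_k ex rC']]; exists k.+1, C'; split=> //.
apply: exits_step => //=; rewrite -[k]addn0.
case: (b c.1) ex => ex.
  by apply: (@exits_embed F (condf b F G) (fun p => Some (inl p)) None _
       _ _ _ _ _ _ _ _ _ ex (exits_done _ _ _)).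
by apply: (@exits_embed G (condf b F G) (fun p => Some (inr p)) None _
       _ _ _ _ _ _ _ _ _ ex (exits_done _ _ _)).
Qed.

Lemma exits_loop G (b : S -> bool) F c n c1 C : runs G c n c1 -> represents C c.2 ->
  exists k C1, [/\ k <= n, represents C1 c1.2 &
  forall m s C', exits (Some (inr None : point (loopf G b F))) c1.1 C1 m s C' ->
    exits (Some (entry (loopf G b F))) c.1 C (k + m) s C'].
Proof.
move=> [rG] rC; have [k [C1 [le_k ex1 rC1]]] := rG _ rC.
exists k, C1; split=> // m s C' ex2.
apply: (@exits_embed G (loopf G b F) inl (Some (inr None)) _ _ _ _ _ _ _ _ _ _ ex1 ex2).
by move=> p /=; congr imap; apply/funext; case.
Qed.

Lemma runs_loop_stop G (b : S -> bool) F c n c1 :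
  runs G c n c1 -> b c1.1 = false -> runs (loopf G b F) c n.+1 c1.
Proof.
move=> rG bF; split=> C rC; have [k [C1 [le_k rC1 ex]]] := exits_loop b F rG rC.
eexists k.+1, _; split; [by [] | rewrite -addn1 | exact: represents_stay rC1].
by apply: ex; apply: exits_step; [rewrite /= bF; reflexivity | exact: exits_done].
Qed.

Lemma runs_loop_next G (b : S -> bool) F c n c1 k c2 m c3 :
  runs G c n c1 -> b c1.1 -> runs F c1 k c2 -> runs (loopf G b F) c2 m c3 ->
  runs (loopf G b F) c (n + k + m).+1 c3.
Proof.
move=> rG bT [rF] [rL]; split=> C rC; have [i [C1 [le_i rC1 ex]]] := exits_loop b F rG rC.
have [j [C2 [le_j ex2 /rL[l [C3 [le_l ex3 rC3]]]]]] := rF _ (represents_stay rC1).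
exists (i + (j + l).+1), C3; split=> //.
  by rewrite addnS ltnS -addnA !leq_add.
apply: ex; apply: exits_step => /=; first by rewrite bT.
apply: (@exits_embed F (loopf G b F) (fun p => inr (Some p))
  (Some (inl (entry G))) _ _ _ _ _ _ _ _ _ _ ex2 ex3).
by move=> p /=; congr imap; apply/funext; case.
Qed.

Definition upd (st : store) (t : T) (x : atape aux) : store :=
  fun t' => if t' == t then x else st t'.

Lemma upd_same st t x : upd st t x t = x.
Proof. by rewrite /upd eqxx. Qed.

Lemma upd_other st t t' x : t' != t -> upd st t x t' = st t'.
Proof. by rewrite /upd => /negPf->. Qed.

Lemma upd_id st t x : st t = x -> upd st t x = st.
Proof. by move=> <-; apply/funext => t'; rewrite /upd; case: eqP => [->|]. Qed.

Lemma upd_upd st t x y : upd (upd st t x) t y = upd st t y.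
Proof. by apply/funext => t'; rewrite /upd; case: eqP. Qed.

Lemma runs_consult i s st w : (st tq).1 = wordf aux w ->
  runs (consult i) (s, st) 1
    (s, upd st tans (wordf aux (enc_dyadic (phi i (size w))), 0)).
Proof.
move=> qw; split=> C rC; eexists 1, _; split=> //=.
  by apply: exits_step; [reflexivity | exact: exits_done].
have wC : word (C tq) = [seq inl a | a <- w] by apply: word_abs; rewrite rC.
by move=> t; rewrite ffunE /upd; case: eqP => // _; rewrite abs_load wC size_map.
Qed.

End Fragments.

Local Notation "F ;; G" := (seqf F G) (at level 60, right associativity).

(** * From a fragment to an oracle machine *)

Section Machine.
Variables (d : nat) (T aux S : finType) (tin tout tq tans : T).
Hypothesis uniqT : uniq [:: tin; tout; tq; tans].
Variables (F : frag d T aux S) (s0 : S).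

Definition machine : otm d :=
  @OTM d (option (point F) * S)%type T aux tin tout tq tans uniqT (Some (entry F), s0)
    (fun q => ~~ isSome q.1)
    (fun q => if q.1 is Some p then
                if code p is Ask i o then Some (i, (o, q.2)) else None
              else None)
    (fun q r => if q.1 is Some p then
                  if code p is Act f then let: (o, s, a) := f q.2 r in ((o, s), a)
                  else (q, stay r)
                else (q, stay r)).

Lemma run_exits (phi : 'I_d -> nat -> rat) o s C n s' C' :
  exits tq tans phi o s C n s' C' ->
  iter n (step phi) (@Config d machine (o, s) C) = @Config d machine (None, s') C'.
Proof.
elim=> // p s1 C1 o1 s2 C2 n1 s3 C3 E _ IH; rewrite iterSr -{}IH; congr iter.
rewrite /step /=; case: (code p) E => [i o2|f] /=; first by case=> <- <- <-.
by case: (f s1 _) => [[o2 s4] a] [<- <- <-].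
Qed.

Lemma iter_halted (phi : 'I_d -> nat -> rat) (M : otm d) (c : config M) n m :
  halted (iter n (step phi) c) -> n <= m -> iter m (step phi) c = iter n (step phi) c.
Proof.
move=> hn /subnK <-; rewrite iterD; elim: (m - n) => //= k ->.
by rewrite /step ifT.
Qed.

Lemma run_machine (phi : 'I_d -> nat -> rat) w n s st v :
  runs tq tans phi F
    (s0, fun t => if t == tin then (wordf aux w, 0) else blank aux) n (s, st) ->
  (st tout).1 = wordf aux v ->
  forall m, n <= m ->
  halted (run machine phi w m) /\ outputs (run machine phi w m) v.
Proof.
move=> [rF] stv m le_nm; pose C0 : {ffun T -> tape_content aux} :=
  [ffun t => load aux (if t == tin then w else [::])].
have [|k [C [le_k ex rC]]] := rF C0.
  move=> t; rewrite ffunE /=; case: eqP => // _; rewrite /abs /=.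
  by congr pair; apply/funext => i; rewrite nth_nil.
have Ek := run_exits ex.
have -> : run machine phi w m = @Config d machine (None, s) C.
  by rewrite /run (@iter_halted _ _ _ k) ?Ek //; exact: leq_trans le_nm.
by split=> //; apply: word_abs; rewrite rC.
Qed.

End Machine.

(* The last symbol read, the sign of the number being processed, two flags, and
   the state of the simulated machine. *)
Record regs (Q : Type) :=
  Regs { cur : option sym; neg : bool; fl1 : bool; fl2 : bool; sta : Q }.

Section RegsFinite.
Variable Q : finType.
Definition regs_code (s : regs Q) := (cur s, neg s, fl1 s, fl2 s, sta s).
Definition regs_decode (x : option sym * bool * bool * bool * Q) : regs Q :=
  let: (a, b, c, d, e) := x in Regs a b c d e.
Lemma regs_codeK : cancel regs_code regs_decode. Proof. by case. Qed.
HB.instance Definition _ := Finite.copy (regs Q) (can_type regs_codeK).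
End RegsFinite.

Definition setcur Q (a : option sym) (s : regs Q) :=
  Regs a (neg s) (fl1 s) (fl2 s) (sta s).
Definition curv Q (s : regs Q) : sym := odflt Zero (cur s).

(** * Elementary operations on stacks, input streams and output tapes *)

Section Primitives.
Variables (d : nat) (T a0 Q : finType).
(* A cell of a simulated tape carries a mark telling whether it is the leftmost
   one; unmarked host blanks are cells that the simulation has not visited. *)
Local Notation aux := (bool * cell a0)%type.
Local Notation S := (regs Q).
Local Notation store := (store T aux).
Local Notation frag := (frag d T aux S).
Variables (tq tans : T) (phi : 'I_d -> nat -> rat).
Local Notation runs := (runs (d := d) (T := T) (aux := aux) tq tans phi).
Implicit Types (s : S) (st : store) (t : T) (l : seq sym).

(* The top of the stack is the last nonblank cell; cell 0 stays blank. *)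
Definition stk l : atape aux :=
  (fun i => if i is j.+1 then wordf aux (rev l) j else None, size l).
(* An input stream, of which [h] symbols have been read and erased. *)
Definition src h (w : seq sym) : atape aux :=
  (fun i => if i < h then None else wordf aux w (i - h), h).
Definition dst (w : seq sym) : atape aux := (wordf aux w, size w).
(* A simulated tape with contents [f] and head position [p], of which the first
   [n] cells have been visited. *)
Definition sim (f : nat -> cell a0) (p n : nat) : atape aux :=
  (fun i => if i < n then Some (inr (i == 0, f i)) else None, p).

Definition sym_of (c : cell aux) : option sym :=
  match c with
  | Some (inl a) => Some a
  | Some (inr (_, Some (inl a))) => Some a
  | _ => None
  end.

Definition on t (f : S -> cell aux -> S * (cell aux * dir)) : frag :=
  basic d (fun s r => ((f s (r t)).1,
    [ffun t' => if t' == t then (f s (r t)).2 else (r t', Stay)])).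

Definition setr (f : S -> S) : frag := basic d (fun s r => (f s, stay r)).
Definition pop t := on t (fun s a => (setcur (sym_of a) s, (None, Left))).
Definition push t (f : S -> sym) : frag :=
  on t (fun s a => (s, (a, Right))) ;; on t (fun s _ => (s, (Some (inl (f s)), Stay))).
Definition get t := on t (fun s a => (setcur (sym_of a) s, (None, Right))).
Definition put t (f : S -> sym) := on t (fun s _ => (s, (Some (inl (f s)), Right))).

Lemma runs_on t f s st :
  let x := f s (aread (st t)) in
  runs (on t f) (s, st) 1 (x.1, upd st t (astep x.2 (st t))).
Proof.
move=> x; have := runs_basic tq tans phi (fun s r => ((f s (r t)).1,
    [ffun t' => if t' == t then (f s (r t)).2 else (r t', Stay)])) s st.
rewrite /= !ffunE; congr (runs _ _ _ (_, _)).
apply/funext => t'; rewrite ffunE /upd; case: eqP => [->//|_].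
by rewrite ffunE astep_stay.
Qed.

Lemma runs_setr f s st : runs (setr f) (s, st) 1 (f s, st).
Proof.
have := runs_basic tq tans phi (fun s r => (f s, stay r)) s st.
rewrite /=; congr (runs _ _ _ (_, _)).
by apply/funext => t; rewrite /stay !ffunE astep_stay.
Qed.

Lemma wordf_rcons l a i : wordf aux (rcons l a) i =
  if i == size l then Some (inl a) else wordf aux l i.
Proof.
rewrite !wordfE size_rcons nth_rcons ltnS leq_eqVlt.
by case: ltngtP => // ->.
Qed.

Lemma aread_stk l : aread (stk l) = if l is a :: _ then Some (inl a) else None.
Proof.
case: l => // a l; rewrite /aread /= rev_cons wordf_rcons size_rev eqxx //.
Qed.

(** On the empty stack the head reads the blank of cell 0 and its left move has no effect. Popping
    is thus always safe, and the arithmetic below uses it to extend a short number by zeros. *)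
Lemma runs_pop t l s st : st t = stk l ->
  runs (pop t) (s, st) 1 (setcur (ohead l) s, upd st t (stk (behead l))).
Proof.
move=> stt; have := runs_on t (fun s a => (setcur (sym_of a) s, (None, Left))) s st.
rewrite stt aread_stk /=; congr (runs _ _ _ (setcur _ _, upd _ _ _)).
  by case: l {stt}.
case: l {stt} => [|a l]; rewrite /stk /astep /=; congr pair; apply/funext => -[|i] //=.
rewrite eqSS rev_cons wordf_rcons size_rev; case: eqP => // ->.
by rewrite wordfE size_rev ltnn.
Qed.

Lemma runs_push t f l s st : st t = stk l ->
  runs (push t f) (s, st) 2 (s, upd st t (stk (f s :: l))).
Proof.
move=> stt; have r1 := runs_on t (fun s a => (s, (a, Right))) s st.
have := runs_seq r1 (runs_on t (fun s _ => (s, (Some (inl (f s)), Stay))) s _).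
rewrite /= upd_same upd_upd stt /=; congr (runs _ _ _ (_, upd _ _ _)).
rewrite /stk /astep /=; congr pair; apply/funext => -[|i] /=.
  by case: l {stt r1}.
rewrite eqSS rev_cons wordf_rcons size_rev; case: eqP => // _.
by case: eqP => // <-.
Qed.

Lemma runs_get t h w s st : st t = src h w ->
  runs (get t) (s, st) 1 (setcur (ohead w) s, upd st t (src h.+1 (behead w))).
Proof.
move=> stt; have := runs_on t (fun s a => (setcur (sym_of a) s, (None, Right))) s st.
rewrite stt /=; congr (runs _ _ _ (setcur _ _, upd _ _ _)).
  by rewrite /aread /= ltnn subnn; case: w {stt}.
rewrite /src /astep /=; congr pair; apply/funext => i; rewrite ltnS (leq_eqVlt i h).
case: ltngtP => //= lt_hi; have -> : i - h = (i - h.+1).+1 by lia.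
by case: w {stt} => [|a w] //; rewrite /wordf !nth_nil.
Qed.

Lemma runs_put t f w s st : st t = dst w ->
  runs (put t f) (s, st) 1 (s, upd st t (dst (rcons w (f s)))).
Proof.
move=> stt; have := runs_on t (fun s _ => (s, (Some (inl (f s)), Right))) s st.
rewrite stt /=; congr (runs _ _ _ (_, upd _ _ _)).
rewrite /dst /astep /= size_rcons; congr pair.
by apply/funext => i; rewrite wordf_rcons.
Qed.

Definition forpop t (F : frag) : frag := loopf (pop t) (fun s => isSome (cur s)) F.

Lemma runs_forpop_nil t F s st : st t = stk [::] ->
  runs (forpop t F) (s, st) 2 (setcur None s, st).
Proof.
move=> stt; have := runs_pop s stt.
by rewrite /= (upd_id stt) => /runs_loop_stop; apply.
Qed.

Lemma runs_forpop_cons t F a l s st n c m c' : st t = stk (a :: l) ->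
  runs F (setcur (Some a) s, upd st t (stk l)) n c -> runs (forpop t F) c m c' ->
  runs (forpop t F) (s, st) (n + m).+2 c'.
Proof. by move=> /(runs_pop s) rP rF rL; apply: (runs_loop_next rP _ rF rL). Qed.

Definition pour t t' : frag := forpop t (push t' (@curv Q)).

Lemma runs_pour t t' l l' s st : t != t' -> st t = stk l -> st t' = stk l' ->
  runs (pour t t') (s, st) (4 * size l).+2
    (setcur None s, upd (upd st t (stk [::])) t' (stk (catrev l l'))).
Proof.
move=> ne; elim: l l' s st => [|a l IHl] l' s st stt stt' /=.
  by rewrite !upd_id //; apply: runs_forpop_nil.
rewrite [X in runs _ _ X](_ : _ = (2 + (4 * size l).+2).+2); last lia.
apply: runs_forpop_cons stt _ _ => /=.
  by apply: runs_push; rewrite /upd [t' == t]eq_sym (negPf ne) stt'.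
have := IHl (a :: l') (setcur (Some a) s) (upd (upd st t (stk l)) t' (stk (a :: l'))).
rewrite upd_same {1}/upd (negPf ne) upd_same => /(_ erefl erefl).
congr (runs _ _ _ (_, _)).
by apply/funext => u; rewrite /upd; case: eqP => //; case: eqP.
Qed.

Definition drain t : frag := forpop t (setr id).

Lemma runs_drain t l s st : st t = stk l ->
  runs (drain t) (s, st) (3 * size l).+2 (setcur None s, upd st t (stk [::])).
Proof.
elim: l s st => [|a l IHl] s st stt /=.
  by rewrite upd_id //; apply: runs_forpop_nil.
rewrite [X in runs _ _ X](_ : _ = (1 + (3 * size l).+2).+2); last lia.
apply: runs_forpop_cons stt _ _ => /=.
  exact: runs_setr.
have := IHl (setcur (Some a) s) (upd st t (stk l)); rewrite upd_same upd_upd.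
exact.
Qed.

Definition skip : frag := setr id.

Fixpoint repf (n : nat) (F : frag) : frag := if n is n'.+1 then F ;; repf n' F else skip.

End Primitives.

(** * Simulation of an oracle machine *)

Section Simulation.
Variables (d d' : nat) (K : finType) (M : otm d').
Local Notation T := (K + tape M)%type.
Local Notation a0 := (aux M).
Local Notation aux := (bool * cell a0)%type.
Local Notation Q := (state M).
Local Notation S := (regs Q).
Local Notation store := (store T aux).
Local Notation frag := (frag d T aux S).
Variables (tq tans : T) (phi : 'I_d -> nat -> rat).
Local Notation runs := (runs (d := d) (T := T) (aux := aux) tq tans phi).
Implicit Types (s : S) (st : store) (t : T) (l : seq sym) (u : tape M).

Definition mark (c : cell aux) : bool := if c is Some (inr (b, _)) then b else false.
Definition content (c : cell aux) : cell a0 := if c is Some (inr (_, a)) then a else None.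

Definition clr s : S := Regs None (neg s) false false (sta s).
Definition setsta (q : Q) s : S := Regs (cur s) (neg s) (fl1 s) (fl2 s) q.

Definition peek u : frag := on d (inr u) (fun s c =>
  (Regs (sym_of c) (neg s) (mark c) (isSome c) (sta s), (c, Stay))).
Definition back u : frag := on d (inr u) (fun s c => (s, (c, Left))).
Definition next u : frag := on d (inr u) (fun s c => (setcur (sym_of c) s, (c, Right))).
Definition tell u (f : S -> cell a0) : frag := on d (inr u) (fun s c =>
  (s, (Some (inr (mark c, f s)), Right))).

Lemma eq_sim (f g : nat -> cell a0) p n :
  (forall i, i < n -> f i = g i) -> sim f p n = sim g p n.
Proof.
move=> fg; rewrite /sim; congr pair; apply/funext => i.
by case: ltnP => // /fg ->.
Qed.

Lemma aread_sim (f : nat -> cell a0) p n :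
  aread (sim f p n) = if p < n then Some (inr (p == 0, f p)) else None.
Proof. by []. Qed.

Lemma runs_peek u f p n s st : st (inr u) = sim f p n ->
  runs (peek u) (s, st) 1
    (Regs (sym_of (aread (sim f p n))) (neg s) ((p == 0) && (p < n)) (p < n) (sta s), st).
Proof.
move=> stu; have := runs_on tq tans phi (inr u) (fun s c =>
  (Regs (sym_of c) (neg s) (mark c) (isSome c) (sta s), (c, Stay))) s st.
rewrite /= astep_stay upd_id // stu aread_sim.
by congr (runs _ _ _ (Regs _ _ _ _ _, _)); case: ltnP; rewrite ?andbT ?andbF.
Qed.

Lemma runs_shift u (m : dir) (g : S -> cell aux -> S) f p n s st : st (inr u) = sim f p n ->
  runs (on d (inr u) (fun s c => (g s c, (c, m)))) (s, st) 1
    (g s (aread (sim f p n)), upd st (inr u) (sim f (ashift m p) n)).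
Proof.
move=> stu; have := runs_on tq tans phi (inr u) (fun s c => (g s c, (c, m))) s st.
rewrite /= stu; congr (runs _ _ _ (_, upd _ _ _)).
rewrite /astep /=; congr pair; apply/funext => i; rewrite /aread /=.
by case: eqP => [->|].
Qed.

Lemma runs_tell u g f p n s st : st (inr u) = sim f p n -> p <= n -> 0 < n ->
  runs (tell u g) (s, st) 1
    (s, upd st (inr u) (sim (fun i => if i == p then g s else f i) p.+1 (maxn n p.+1))).
Proof.
move=> stu le_pn n_gt0; have := runs_on tq tans phi (inr u)
  (fun s c => (s, (Some (inr (mark c, g s)), Right))) s st.
rewrite /= stu; congr (runs _ _ _ (_, upd _ _ _)).
rewrite /astep /=; congr pair; apply/funext => i.
case: eqP => [->|ne_ip].
  rewrite leq_max ltnS leqnn orbT; case: ltnP => //= le_np.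
  by rewrite gtn_eqF //; lia.
by have -> : (i < maxn n p.+1) = (i < n) by lia.
Qed.

(** A left move on cell 0 is silent, so the left end cannot be sensed; the mark on the leftmost cell
    makes it observable. *)
Definition rewind u : frag :=
  loopf (peek u) (fun s => ~~ fl1 s) (back u) ;; setr d T a0 clr.

Lemma runs_rewind u f p n s st : st (inr u) = sim f p n -> 0 < n ->
  runs (rewind u) (s, st) (3 * p + 3) (clr s, upd st (inr u) (sim f 0 n)).
Proof.
move=> stu n_gt0.
suff rL : runs (loopf (peek u) (fun s => ~~ fl1 s) (back u)) (s, st) (3 * p + 2)
   (Regs (sym_of (aread (sim f 0 n))) (neg s) true true (sta s),
    upd st (inr u) (sim f 0 n)).
  by rewrite addnS -addn1; apply: runs_seq rL (runs_setr _ _ _ _ _ _).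
elim: p s st stu => [|p IHp] s st stu.
  have := runs_peek s stu; rewrite upd_id // n_gt0 => rP.
  exact: runs_loop_stop rP _.
rewrite [X in runs _ _ X](_ : _ = (1 + 1 + (3 * p + 2)).+1); last lia.
apply: runs_loop_next (runs_peek s stu) _ (runs_shift Left (fun s _ => s) _ stu) _ => //.
have := IHp _ _ (upd_same st (inr u) (sim f p n)); rewrite upd_upd; exact.
Qed.

(** Symbols of the simulated machine lie on visited cells only, so erasing may stop at the first
    unvisited one. *)
Definition erase u : frag := loopf (peek u) (@fl2 Q) (tell u (fun=> None)).

Lemma runs_erase u f p n s st : st (inr u) = sim f p n -> p <= n -> 0 < n ->
  runs (erase u) (s, st) (3 * (n - p) + 2)
    (Regs None (neg s) false false (sta s),
     upd st (inr u) (sim (fun i => if i < p then f i else None) n n)).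
Proof.
move: {2}(n - p) (erefl (n - p)) => k; elim: k f p s st => [|k IHk] f p s st Ek stu le_pn n_gt0.
  have -> : p = n by lia.
  have Epn : p = n by lia.
  have := runs_peek s stu; rewrite aread_sim Epn subnn ltnn andbF => rP.
  rewrite upd_id; last by rewrite stu Epn; apply: eq_sim => i ->.
  exact: runs_loop_stop rP _.
rewrite [X in runs _ _ X](_ : _ = (1 + 1 + (3 * (n - p.+1) + 2)).+1); last lia.
apply: runs_loop_next (runs_peek s stu) _ (runs_tell _ _ stu le_pn n_gt0) _.
  by rewrite /=; lia.
have -> : maxn n p.+1 = n by lia.
have := IHk _ p.+1 _ _ _ (upd_same st (inr u)
  (sim (fun i => if i == p then None else f i) p.+1 n)); rewrite upd_upd => IH.
rewrite (_ : sim (fun i => if i < p then f i else None) n n = sim (fun i =>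
  if i < p.+1 then if i == p then None else f i else None) n n).
  by apply: IH; lia.
apply: eq_sim => i _; rewrite ltnS (leq_eqVlt i); case: eqP => [->|] //=.
by rewrite ltnn.
Qed.

Variable z : K.

Definition copy u (k : K) : frag := forpop (inl k)
  (tell u (fun s => Some (inl (curv s))) ;; push d a0 (inl z) (@curv Q)).

Lemma runs_copy u k f p n l lz s st : k != z ->
  st (inr u) = sim f p n -> st (inl k) = stk a0 l -> st (inl z) = stk a0 lz ->
  p <= n -> 0 < n ->
  runs (copy u k) (s, st) (5 * size l + 2)
    (setcur None s,
     upd (upd (upd st (inl k) (stk a0 [::])) (inl z) (stk a0 (catrev l lz))) (inr u)
      (sim (fun i => if p <= i < p + size l then Some (inl (nth Zero l (i - p))) else f i)
           (p + size l) (maxn n (p + size l)))).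
Proof.
move=> ne_kz; elim: l lz f p n s st => [|a l IHl] lz f p n s st stu sk stz le_pn n_gt0.
  rewrite (@upd_id _ _ st) // (@upd_id _ _ st) // upd_id; first exact: runs_forpop_nil.
  rewrite addn0 stu; have -> : maxn n p = n by lia.
  by apply: eq_sim => i _; case: ifP => //; lia.
apply: runs_to.
- apply: runs_forpop_cons sk _ _.
    apply: runs_seq; first by apply: runs_tell stu _ _.
    by apply: runs_push; rewrite !upd_other ?stz // eq_sym.
  apply: IHl; first by rewrite upd_other // upd_same.
  + by rewrite upd_other // upd_other // upd_same.
  + by rewrite upd_same.
  + by lia.
  by lia.
- by rewrite /=; lia.
congr (setcur _ _, _); apply/funext => -[k'|u'].
  rewrite /upd !(inj_eq inl_inj) /=.
  by case: eqP => // _; case: eqP.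
rewrite /upd /=; case: eqP => // _; rewrite /curv /= -addSnnS.
rewrite (_ : maxn (maxn n p.+1) _ = maxn n (p.+1 + size l)); last lia.
congr (sim _ _ _).
apply/funext => i; case: (ltngtP p i) => [lt_pi|lt_ip|->].
- by have -> : i - p = (i - p.+1).+1 by lia.
- by [].
by rewrite subnn /= ltn_addr.
Qed.

(** An oracle answer replaces the whole content of the answer tape, hence the erasure beyond the new
    word. The detour through [z] restores the word on [k] for the next call. *)
Definition stow u (k : K) : frag :=
  rewind u ;; copy u k ;; pour d _ Q (inl z) (inl k) ;; erase u ;; rewind u.

Lemma runs_stow u k f p n w s st : k != z ->
  st (inr u) = sim f p n -> st (inl k) = stk a0 w -> st (inl z) = stk a0 [::] ->
  p <= n -> 0 < n ->
  runs (stow u k) (s, st) (20 * (n + size w) + 20)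
    (clr s, upd st (inr u) (sim (wordf a0 w) 0 (maxn n (size w)))).
Proof.
move=> ne_kz stu sk stz le_pn n_gt0; apply: runs_to.
- apply: runs_seq; first by apply: runs_rewind stu _.
  apply: runs_seq.
    apply: (runs_copy _ ne_kz); first by rewrite upd_same.
    + by rewrite upd_other // sk.
    + by rewrite upd_other // stz.
    + by [].
    by [].
  apply: runs_seq.
    apply: runs_pour; first by rewrite (inj_eq inl_inj) eq_sym; exact: ne_kz.
    + by rewrite upd_other // upd_same.
    by rewrite upd_other // upd_other ?(inj_eq inl_inj) // upd_same.
  apply: runs_seq.
    apply: runs_erase; first by rewrite upd_other // upd_other // upd_same.
    + by lia.
    by lia.
  by apply: runs_rewind; [by rewrite upd_same | lia].
- by rewrite catrevE size_cat size_rev /=; lia.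
congr pair; apply/funext => -[k'|u'].
  rewrite /upd !(inj_eq inl_inj) /=.
  case: eqP => [->|_]; first by rewrite sk !catrevE !cats0 revK.
  by case: eqP => // ->.
rewrite /upd /=; case: eqP => // _; rewrite add0n; apply: eq_sim => i lt_i.
by rewrite wordfE subn0; case: (i < size w).
Qed.
Definition advance_act s (r : {ffun T -> cell aux}) : S * {ffun T -> cell aux * dir} :=
  let x := delta (sta s) [ffun u => content (r (inr u))] in
  (setsta x.1 (clr s), [ffun t => match t with
     | inl k => (r (inl k), Stay)
     | inr u => (Some (inr (mark (r (inr u)), (x.2 u).1)), (x.2 u).2)
     end]).
Definition advance : frag := basic d advance_act.

(** The head may stand on the first unvisited cell, hence [head <= n]; [0 < n] keeps the mark of
    cell 0 in place; [b] is the space bound from which the cost of an oracle call is computed. *)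
Definition simulates (c : config M) (b : nat) st : Prop := forall u, exists n,
  let t := contents c u in
  [/\ Defs.head t <= n, n <= b, 0 < n, st (inr u) = sim (nth None (cells t)) (Defs.head t) n &
      forall i, n <= i -> nth None (cells t) i = None].

Variables k0 k1 : K.
Hypotheses (ne_k0z : k0 != z) (ne_k1z : k1 != z).

Definition first_oracle s : bool :=
  if query (sta s) is Some (i, _) then i == 0 :> nat else true.

(* The oracles of [M] are taken to be constant, with the answers kept on the
   stacks [k0] and [k1]. *)
Definition answered : frag :=
  condf first_oracle (stow (answer M) k0) (stow (answer M) k1) ;;
  setr d T a0 (fun s => setsta (if query (sta s) is Some (_, q) then q else sta s) s).

Definition onestep : frag := condf (fun s => isSome (query (sta s))) answered advance.

Variables (psi : 'I_d' -> nat -> rat) (w0 w1 : seq sym).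
Hypothesis psiE : forall i m, enc_dyadic (psi i m) = if i == 0 :> nat then w0 else w1.

Definition oracles_ready st : Prop :=
  [/\ st (inl k0) = stk a0 w0, st (inl k1) = stk a0 w1 & st (inl z) = stk a0 [::]].

Lemma runs_advance c b s st : sta s = current c -> query (current c) = None ->
  ~~ halted c -> simulates c b st ->
  exists st', [/\ runs advance (s, st) 1 (setsta (current (step psi c)) (clr s), st'),
    simulates (step psi c) b.+1 st' & forall k, st' (inl k) = st (inl k)].
Proof.
move=> sc qN /negPf nf sim_c; rewrite /halted in nf; rewrite /step nf qN.
pose r : {ffun T -> cell aux} := [ffun t => aread (st t)].
have rE : [ffun u => content (r (inr u))] = [ffun u => read (contents c u)].
  apply/ffunP => u; rewrite !ffunE; have [n [le_hn _ _ -> fn]] := sim_c u.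
  by rewrite aread_sim; case: ltnP => //= le_nh; rewrite /read fn.
have := runs_basic tq tans phi advance_act s st.
rewrite -/r /advance_act rE sc /=; case: (delta _ _) => q act /= rA.
exists (fun t => astep ([ffun t => match t with
     | inl k => (r (inl k), Stay)
     | inr u => (Some (inr (mark (r (inr u)), (act u).1)), (act u).2)
     end] t) (st t)); split=> [//|u|k]; last by rewrite !ffunE astep_stay.
have [n [le_hn le_nb n_gt0 stu fn]] := sim_c u.
set h := Defs.head (contents c u) in le_hn stu.
exists (maxn n h.+1); rewrite /= !ffunE -/h; split.
- by case: (act u) => a [] /=; rewrite -/h; lia.
- by lia.
- by lia.
- rewrite stu aread_sim /astep /= /sim; congr pair.
  apply/funext => i; rewrite nth_set_nth /= -/h.
  case: eqP => [->|ne_ih]; last by have -> : (i < maxn n h.+1) = (i < n) by lia.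
  rewrite leq_max ltnSn orbT; case: ltnP => //= le_nh.
  by rewrite gtn_eqF //; lia.
move=> i; rewrite geq_max => /andP[le_ni lt_hi].
by rewrite nth_set_nth /= -/h gtn_eqF // fn.
Qed.

Lemma runs_answered c b i q s st : sta s = current c -> query (current c) = Some (i, q) ->
  ~~ halted c -> simulates c b st -> oracles_ready st -> size w0 <= b -> size w1 <= b ->
  exists st', [/\ runs answered (s, st) (40 * b + 22) (setsta (current (step psi c)) (clr s), st'),
    simulates (step psi c) b st' & forall k, st' (inl k) = st (inl k)].
Proof.
move=> sc qi /negPf nf sim_c [st0 st1 stz] le_w0 le_w1; rewrite /halted in nf.
rewrite /step nf qi /=; set w := enc_dyadic _.
have wE : w = if i == 0 :> nat then w0 else w1 by apply: psiE.
have [n [le_hn le_nb n_gt0 stu fn]] := sim_c (answer M).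
set st' := upd st (inr (answer M)) (sim (wordf a0 w) 0 (maxn n (size w))).
have rS : runs (condf first_oracle (stow (answer M) k0) (stow (answer M) k1))
    (s, st) (40 * b + 21) (clr s, st').
  apply: runs_to; last by [].
    apply: runs_cond; rewrite /first_oracle /= sc qi /st'.
    case: eqP wE => i0 ->.
      exact: runs_stow ne_k0z stu st0 stz le_hn n_gt0.
    exact: runs_stow ne_k1z stu st1 stz le_hn n_gt0.
  by case: ifP wE => _ ->; lia.
exists st'; split=> [|u|k]; last by rewrite /st' upd_other.
- apply: runs_to; first by apply: runs_seq rS (runs_setr _ _ _ _ _ _).
    by lia.
  by rewrite /= sc qi.
rewrite ffunE /st' /upd (inj_eq inr_inj); case: eqP => _; last exact: sim_c.
exists (maxn n (size w)) => /=; split=> //; try by lia.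
  by case: ifP wE => _ ->; lia.
by move=> j le_j; rewrite nth_default // size_map; lia.
Qed.

Lemma runs_onestep c b s st : sta s = current c -> ~~ halted c -> simulates c b st ->
  oracles_ready st -> size w0 <= b -> size w1 <= b ->
  exists st', [/\ runs onestep (s, st) (40 * b + 23) (setsta (current (step psi c)) (clr s), st'),
    simulates (step psi c) b.+1 st' & forall k, st' (inl k) = st (inl k)].
Proof.
move=> sc nh sim_c or_st le_w0 le_w1.
case E: (query (current c)) => [[i q]|].
  have [st' [rA sim_c' stE]] := runs_answered sc E nh sim_c or_st le_w0 le_w1.
  exists st'; split=> // [|u]; last first.
    by have [n [? ? ? ? ?]] := sim_c' u; exists n; split=> //; lia.
  by rewrite addnS; apply: runs_cond; rewrite /= sc E.
have [st' [rA sim_c' stE]] := runs_advance sc E nh sim_c.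
exists st'; split=> //; apply: runs_to; first by apply: runs_cond; rewrite /= sc E; exact: rA.
  by lia.
by [].
Qed.

Definition execute : frag :=
  loopf (skip d T a0 Q) (fun s => ~~ final (sta s)) onestep ;; setr d T a0 clr.

(** Each simulated step visits at most one new cell per tape, or stores an oracle word of length at
    most [n]. So [n + t] bounds the space throughout, and every step costs at most a multiple of
    it. *)
Lemma runs_execute b (t : nat) c n s st : sta s = current c -> halted (iter t (step psi) c) ->
  simulates c n st -> n + t <= b -> oracles_ready st -> size w0 <= n -> size w1 <= n ->
  exists st', [/\ runs execute (s, st) (t * (40 * b + 25) + 3)
      (setsta (current (iter t (step psi) c)) (clr s), st'),
    simulates (iter t (step psi) c) b st' & forall k, st' (inl k) = st (inl k)].
Proof.
move=> sc ht sim_c le_nb or_st le_w0 le_w1.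
suff [s' [st' [rL s'E sim_c' stE]]] : exists s' st',
  [/\ runs (loopf (skip d T a0 Q) (fun s => ~~ final (sta s)) onestep) (s, st)
         (t * (40 * b + 25) + 2) (s', st'),
      clr s' = setsta (current (iter t (step psi) c)) (clr s),
      simulates (iter t (step psi) c) b st' & forall k, st' (inl k) = st (inl k)].
  exists st'; split=> //; apply: runs_to; first by apply: runs_seq rL (runs_setr _ _ _ _ _ _).
    by lia.
  by rewrite s'E.
elim: t c n s st sc ht sim_c le_nb or_st le_w0 le_w1 => [|t IHt] c n s st sc ht sim_c le_nb
  or_st le_w0 le_w1.
  exists s, st; split=> //; last 1 first.
  - by move=> u; have [m [? ? ? ? ?]] := sim_c u; exists m; split=> //; lia.
  - by apply: runs_loop_stop; [exact: runs_setr | rewrite /= sc; apply: negbF].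
  by rewrite /clr /setsta /= sc.
(* The number [t] only bounds the running time: a machine that halts earlier stays in its final
   configuration. *)
have [hc|nhc] := boolP (halted c).
  have cE : iter t.+1 (step psi) c = c by rewrite (@iter_halted _ _ _ c 0).
  rewrite cE; exists s, st; split=> //.
  - apply: runs_le; last first.
      by apply: runs_loop_stop; [exact: runs_setr | rewrite /= sc; apply: negbF].
    by lia.
  - by rewrite /clr /setsta /= sc.
  by move=> u; have [m [? ? ? ? ?]] := sim_c u; exists m; split=> //; lia.
have [st1 [r1 sim_c1 st1E]] := runs_onestep sc nhc sim_c or_st le_w0 le_w1.
rewrite iterSr in ht *.
have or_st1 : oracles_ready st1 by rewrite /oracles_ready !st1E.
have [] := IHt (step psi c) n.+1 (setsta (current (step psi c)) (clr s)) st1; rewrite ?addSnnS //; try lia.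
move=> s' [st' [rL s'E sim_c' stE]]; exists s', st'; split=> //.
- apply: runs_to; first apply: runs_loop_next (runs_setr _ _ _ _ _ _) _ r1 rL.
  + by rewrite /= sc.
  + by lia.
  by [].
by move=> k; rewrite stE st1E.
Qed.

Definition prepare : frag := basic d (fun s r => (setsta (start M) (clr s),
  [ffun t => match t with
     | inl k => (r (inl k), Stay)
     | inr u => (Some (inr (true, None)), Stay)
     end])).

Lemma runs_prepare s st : (forall u, st (inr u) = blank aux) ->
  runs prepare (s, st) 1 (setsta (start M) (clr s),
    fun t => if t is inr u then sim (fun=> None) 0 1 else st t).
Proof.
move=> stu; apply: runs_to; [exact: runs_basic | by [] |].
congr pair; apply/funext => -[k|u] /=; rewrite !ffunE ?astep_stay //.
rewrite stu /astep /sim /=; congr pair.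
by apply/funext => -[|i].
Qed.

Definition nexts u : frag :=
  loopf (next u) (fun s => isSome (cur s)) (push d a0 (inl z) (@curv Q)).

Lemma runs_nexts u f p n v lz s st :
  st (inr u) = sim f p n -> st (inl z) = stk a0 lz ->
  (forall i, i <= size v -> f (p + i) = wordf a0 v i) -> (forall i, n <= i -> f i = None) ->
  runs (nexts u) (s, st) (4 * size v + 2) (setcur None s,
   upd (upd st (inl z) (stk a0 (catrev v lz))) (inr u) (sim f (p + size v).+1 n)).
Proof.
move=> stu stz fv fn; elim: v lz p s st stu stz fv => [|a v IHv] lz p s st stu stz fv.
  have := runs_shift Right (fun s c => setcur (sym_of c) s) s stu.
  rewrite aread_sim -[p in f p]addn0 fv //= (_ : sym_of _ = None) => [rN|]; last by case: ifP.
  by rewrite addn0 (upd_id stz); exact: runs_loop_stop rN _.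
have lt_pn : p < n by rewrite ltnNge; apply/negP => /fn; rewrite -[p]addn0 fv.
have := runs_shift Right (fun s c => setcur (sym_of c) s) s stu.
rewrite aread_sim -[p in f p]addn0 fv // lt_pn => rN.
apply: runs_to; first apply: (runs_loop_next rN).
- by [].
- by apply: runs_push; rewrite upd_other // stz.
- apply: IHv; first by rewrite upd_other // upd_same.
    by rewrite upd_same.
  by move=> i le_i; rewrite addSnnS fv.
- by rewrite /=; lia.
congr pair; apply/funext => -[k|u']; rewrite /upd /=.
  by case: eqP.
by rewrite -addSnnS; case: eqP.
Qed.

Definition transcribe u (k : K) : frag :=
  nexts u ;; pour d _ Q (inl z) (inl k) ;; setr d T a0 clr.

Lemma runs_transcribe u k f n v s st : k != z ->
  st (inr u) = sim f 0 n -> st (inl k) = stk a0 [::] -> st (inl z) = stk a0 [::] ->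
  (forall i, i <= size v -> f i = wordf a0 v i) -> (forall i, n <= i -> f i = None) ->
  runs (transcribe u k) (s, st) (8 * size v + 5)
    (clr s, upd (upd st (inl k) (stk a0 v)) (inr u) (sim f (size v).+1 n)).
Proof.
move=> ne_kz stu sk stz fv fn.
have nek : (inl k : T) != inl z by rewrite (inj_eq inl_inj).
apply: runs_to.
- apply: runs_seq; first by apply: (@runs_nexts u f 0 n v [::]).
  apply: runs_seq; first apply: runs_pour; first by rewrite eq_sym; exact: nek.
  + by rewrite upd_other // upd_same.
  + by rewrite !upd_other ?sk.
  exact: runs_setr.
- by rewrite catrevE cats0 size_rev; lia.
congr pair; apply/funext => -[k'|u']; rewrite /upd /= ?(inj_eq inl_inj) ?(inj_eq inr_inj).
  case: eqP => // _; first by rewrite !catrevE !cats0 revK.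
  by case: eqP => // ->.
by [].
Qed.

Definition simulate (kin kout : K) : frag :=
  prepare ;; stow (input M) kin ;; execute ;; rewind (output M) ;;
  transcribe (output M) kout ;; setr d T a0 (setsta (start M)).

(** The output word lies on visited cells, of which there are at most [b]. This bound on [size v] is
    what the time analysis of the fragments that process the answer rests on. *)
Lemma runs_simulate kin kout win (t : nat) v s st : kin != z -> kout != z ->
  (forall u, st (inr u) = blank aux) -> st (inl kin) = stk a0 win ->
  st (inl kout) = stk a0 [::] -> oracles_ready st ->
  halted (run M psi win t) -> outputs (run M psi win t) v ->
  let b := (size win + size w0 + size w1 + t).+1 in
  size v <= b /\ exists st', [/\ runs (simulate kin kout) (s, st) (200 * b * b)
      (setsta (start M) (clr s), st'),
    st' (inl kout) = stk a0 v & forall k, k != kout -> st' (inl k) = st (inl k)].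
Proof.
move=> ne_in ne_out stu skin skout [st0 st1 stz] ht outv b.
pose n0 := (size win + size w0 + size w1).+1.
pose st2 : store := fun t => if t is inr u then sim (fun=> None) 0 1 else st t.
pose st3 := upd st2 (inr (input M)) (sim (wordf a0 win) 0 (maxn 1 (size win))).
have sim3 : simulates (init M win) n0 st3.
  move=> u; exists (if u == input M then maxn 1 (size win) else 1).
  rewrite /= ffunE /st3 /upd (inj_eq inr_inj) /n0; case: eqP => _; split=> //; try lia.
  - by move=> i le_i; rewrite nth_default // size_map; lia.
  - by rewrite /st2; apply: eq_sim => i _; rewrite nth_nil.
  by move=> i _; rewrite nth_nil.
have or3 : oracles_ready st3 by [].
have le_b : n0 + t <= b by rewrite /n0 /b; lia.
have le0 : size w0 <= n0 by rewrite /n0; lia.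
have le1 : size w1 <= n0 by rewrite /n0; lia.
have [st4 [r4 sim4 st4E]] := @runs_execute b t (init M win) n0
  (setsta (start M) (clr s)) st3 erefl ht sim3 le_b or3 le0 le1.
have [n [le_hn le_nb n_gt0 sto fn]] := sim4 (output M).
set f := nth None _ in sto fn.
have fv : forall i, i <= size v -> f i = wordf a0 v i by move=> i; exact: abs_word.
have le_v : size v <= n.
  rewrite leqNgt; apply/negP => lt_n; have := fn n (leqnn _).
  by rewrite fv ?wordfE ?lt_n // ltnW.
split; first exact: leq_trans le_nb.
eexists; split; first apply: runs_to.
- apply: runs_seq; first exact: runs_prepare.
  apply: runs_seq.
    by apply: (@runs_stow (input M) kin (fun=> None) 0 1 win).
  apply: runs_seq; first exact: r4.
  apply: runs_seq; first by apply: runs_rewind sto _.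
  apply: runs_seq; first apply: (runs_transcribe _ ne_out); first by rewrite upd_same.
  - by rewrite upd_other // st4E.
  - by rewrite upd_other // st4E.
  - exact: fv.
  - exact: fn.
  exact: runs_setr.
- have le_tb : t <= b by rewrite /b; lia.
  have le_wb : size win <= b by rewrite /b; lia.
  have b_gt0 : 0 < b by [].
  have := leq_mul le_tb (leqnn b); have := leq_mul b_gt0 (leqnn b).
  by move: (Defs.head _) le_hn => h; clearbody b; lia.
- by [].
- by rewrite /upd /= eqxx.
by move=> k ne_k; rewrite /upd /= (inj_eq inl_inj) (negPf ne_k) st4E.
Qed.

End Simulation.

(** * Binary numerals *)

Section Numerals.

Definition bit (b : bool) : sym := if b then One else Zero.
Definition bits (l : seq bool) : seq sym := map bit l.

(* Least significant bit first. *)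
Fixpoint bval (l : seq bool) : nat := if l is b :: l' then b + (bval l').*2 else 0.

Lemma bval_cat l1 l2 : bval (l1 ++ l2) = bval l1 + bval l2 * 2 ^ size l1.
Proof. by elim: l1 => [|b l1 IH] /=; rewrite ?muln1 // IH expnS; lia. Qed.

Lemma bval_lt l : bval l < 2 ^ size l.
Proof. by elim: l => //= b l IH; rewrite expnS; case: b; lia. Qed.

Lemma bval_zeros n : bval (nseq n false) = 0.
Proof. by elim: n => //= n ->. Qed.

Lemma bval_rcons l b : bval (rcons l b) = bval l + b * 2 ^ size l.
Proof. by rewrite -cats1 bval_cat /= double0 addn0. Qed.

Lemma digitsS m b : digits m b.+1 = rcons (digits m./2 b) (bit (odd m)).
Proof.
rewrite /digits mkseqS subnn expn0 divn1; congr rcons.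
apply/eq_in_map => i; rewrite mem_iota /= add0n => lt_ib.
have -> : b.+1 - i.+1 = (b - i.+1).+1 by lia.
by rewrite expnS divnMA divn2.
Qed.

Lemma bval_drop n (l : seq bool) : bval (drop n l) = bval l %/ 2 ^ n.
Proof.
elim: n l => [|n IH] [|b l] //=; rewrite ?drop0 ?divn1 ?div0n //.
by rewrite IH expnS divnMA divn2 half_bit_double.
Qed.

Lemma size_digits m b : size (digits m b) = b.
Proof. exact: size_mkseq. Qed.

Lemma digits_bval l : digits (bval l) (size l) = bits (rev l).
Proof.
elim: l => // b l IH; rewrite /= digitsS rev_cons /bits map_rcons -/(bits _).
by rewrite -IH oddD odd_double addbF oddb half_bit_double.
Qed.

Lemma bin_bval l : bin (bval (rcons l true)) = bits (rev (rcons l true)).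
Proof.
rewrite -digits_bval /bin size_rcons; congr (digits _ _.+1).
apply: trunc_log_eq => //; rewrite bval_rcons mul1n leq_addl /= expnS.
by have := bval_lt l; lia.
Qed.

Lemma bin0 : bin 0 = [:: Zero].
Proof. by rewrite /bin trunc_log0. Qed.

Lemma bits_digits m b : exists2 l, digits m b = bits (rev l) & size l = b /\ bval l = m %% 2 ^ b.
Proof.
elim: b m => [|b IH] m; first by exists [::]; rewrite // expn0 modn1.
have [l El [sl vl]] := IH m./2; exists (odd m :: l).
  by rewrite digitsS El rev_cons /bits map_rcons.
split; rewrite /= ?sl // vl.
have mE : m = m./2 %/ 2 ^ b * 2 ^ b.+1 + (odd m + (m./2 %% 2 ^ b).*2).
  have := odd_double_half m; have := divn_eq m./2 (2 ^ b); rewrite expnS mulnCA.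
  by move: (_ * _) (_ %% _) => x y; lia.
rewrite [in RHS]mE modnMDl [RHS]modn_small // expnS.
have : m./2 %% 2 ^ b < 2 ^ b by rewrite ltn_pmod ?expn_gt0.
by case: (odd m); lia.
Qed.

Lemma bits_bin m : exists2 l, bin m = bits (rev l) &
  bval l = m /\ size l = (trunc_log 2 m).+1.
Proof.
have [l El [sl vl]] := bits_digits m (trunc_log 2 m).+1.
by exists l => //; rewrite vl modn_small // trunc_log_ltn.
Qed.

Lemma size_bits (l : seq bool) : size (bits l) = size l.
Proof. exact: size_map. Qed.

Lemma catrev_bits (l1 l2 : seq bool) : catrev (bits l1) (bits l2) = bits (catrev l1 l2).
Proof. by rewrite !catrevE /bits map_cat map_rev. Qed.

Lemma catrev_bits0 (l : seq bool) : catrev (bits (rev l)) [::] = bits l.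
Proof. by rewrite (catrev_bits _ [::]) catrevE cats0 revK. Qed.

Lemma bval_rev_cons b l : bval (rev (b :: l)) = bval (rev l) + b * 2 ^ size l.
Proof. by rewrite rev_cons bval_rcons size_rev. Qed.

Lemma enc_int_bval (z : int) : exists l,
  [/\ enc_int z = nseq (z < 0)%R Minus ++ bits (rev l), bval l = `|z|%N & 0 < size l].
Proof. by have [l El [vl sl]] := bits_bin `|z|; exists l; rewrite /enc_int El sl. Qed.

Local Open Scope ring_scope.

Definition dy (s : bool) (V m : nat) : rat := (-1) ^+ s * V%:R / 2 ^+ m.

Lemma dy_lt0 s V m : (dy s V m < 0) = s && (V != 0%N).
Proof.
rewrite /dy pmulr_llt0 ?invr_gt0 ?exprn_gt0 //; case: s => /=.
  by rewrite expr1 mulN1r oppr_lt0 ltr0n lt0n.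
by rewrite expr0 mul1r ltNge ler0n.
Qed.

Lemma dy_double s V m : dy s V.*2 m.+1 = dy s V m.
Proof.
by rewrite /dy -muln2 natrM exprS; field; rewrite expf_neq0.
Qed.

(** The hypothesis puts the fraction in lowest terms, so [numq] and [denq] are read off by
    coprimality. *)
Lemma enc_dy s V m : (m == 0)%N || odd V ->
  enc_dyadic (dy s V m) =
  nseq (s && (V != 0%N)) Minus ++ bin (V %/ 2 ^ m) ++ Point :: digits V m.
Proof.
move=> mV.
have sV : `|((-1) ^+ s * V%:Z : int)|%N = V by case: (s); rewrite ?expr1 ?expr0 ?mulN1r ?mul1r ?abszN.
have cop : coprime `|(-1) ^+ s * V%:Z| `|2 ^+ m : int|.
  rewrite sV abszX.
  by case/orP: mV => [/eqP->|oV]; rewrite ?coprimen1 // coprimeXr ?coprimen2.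
have E : dy s V m = ((-1) ^+ s * V%:Z)%:~R / (2 ^+ m : int)%:~R.
  by rewrite /dy rmorphM !rmorphXn.
rewrite /enc_dyadic dy_lt0 E coprimeq_num // coprimeq_den //.
rewrite gtr0_sg ?exprn_gt0 // mul1r sV expf_eq0 andbF.
have -> : `|(`|2 ^+ m| : int)|%N = (2 ^ m)%N by rewrite normrX abszX.
by rewrite pfactorK.
Qed.

Lemma dy_reduce V m : exists V' j, [/\ (j == 0)%N || odd V', (V' <= V)%N, (j <= m)%N &
  forall s, dy s V m = dy s V' j].
Proof.
elim: m V => [|m IH] V; first by exists V, 0%N.
have [oV|eV] := boolP (odd V); first by exists V, m.+1; rewrite oV orbT.
have [V' [j [jV leV lej E]]] := IH V./2; exists V', j; split=> //.
- by apply: leq_trans leV _; rewrite -divn2 leq_div.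
- exact: leqW.
by move=> s; rewrite -[V]even_halfK // dy_double.
Qed.

Lemma size_enc_dy s q m : (size (enc_dyadic (dy s (bval q) m)) <= size q + m + 3)%N.
Proof.
have [V [j [jV leV lej ->]]] := dy_reduce (bval q) m; rewrite enc_dy //.
rewrite -(cat1s Point) !size_cat size_nseq /bin !size_digits.
have : (trunc_log 2 (V %/ 2 ^ j) <= size q)%N.
  rewrite -[X in (_ <= X)%N](trunc_expnK (p := 2) (size q)) //.
  apply: leq_trunc_log; apply: leq_trans (leq_div _ _) _.
  exact: leq_trans leV (ltnW (bval_lt q)).
by case: (s && _) => /=; lia.
Qed.

Lemma dyadic_dy q : dyadic q -> exists s V m, ((m == 0)%N || odd V) /\ q = dy s V m.
Proof.
move=> [a [b ->]].
have {a} [s [V ->]] : exists (s : bool) (V : nat), (a%:~R : rat) = (-1) ^+ s * V%:R.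
  case: a => n; first by exists false, n; rewrite expr0 mul1r.
  by exists true, n.+1; rewrite expr1 mulN1r NegzE mulrNz.
by have [V' [j [jV _ _ E]]] := dy_reduce V b; exists s, V', j; split=> //; exact: E.
Qed.

End Numerals.

(** * The machines *)

(* Apart from the four prescribed tapes, all tapes are used as stacks. Numbers
   are kept in binary with the least significant digit on top: [SX] and [SY] are
   the arguments, [SQ] the number to be printed, [SR] the remainder of the
   division and the accumulator of the multiplication; [SC], [SD] and [SN] are
   unary counters, [SW] holds a word to be printed or the first oracle word, [SX]
   also the second oracle word, [SV] the output of the simulated machine, and
   [SZ], [ST], [SU], [SP] are scratch. *)
Inductive tname :=
  TIn | TOut | TQ | TAns | SX | SY | SZ | SR | SQ | SW | SV | SC | SD | SN | ST | SU | SP.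

Definition tname_list :=
  [:: TIn; TOut; TQ; TAns; SX; SY; SZ; SR; SQ; SW; SV; SC; SD; SN; ST; SU; SP].

Definition tname_code (t : tname) : nat :=
  match t with
  | TIn => 0 | TOut => 1 | TQ => 2 | TAns => 3 | SX => 4 | SY => 5 | SZ => 6 | SR => 7
  | SQ => 8 | SW => 9 | SV => 10 | SC => 11 | SD => 12 | SN => 13 | ST => 14 | SU => 15
  | SP => 16
  end.

Lemma tname_codeK : pcancel tname_code (fun i => nth None (map Some tname_list) i).
Proof. by case. Qed.

Lemma tname_eqP : Equality.axiom (fun x y => tname_code x == tname_code y).
Proof. by move=> x y; apply: (iffP eqP) => [/(pcan_inj tname_codeK)|->]. Qed.

HB.instance Definition _ := hasDecEq.Build tname tname_eqP.
HB.instance Definition _ := PCanIsCountable tname_codeK.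

Lemma tname_enumP : Finite.axiom tname_list.
Proof. by case. Qed.

HB.instance Definition _ := isFinite.Build tname tname_enumP.

Definition is_one Q (s : regs Q) := if cur s is Some One then true else false.
Definition is_zero Q (s : regs Q) := if cur s is Some Zero then true else false.
Definition is_digit Q (s : regs Q) := if cur s is Some (Zero | One) then true else false.
Definition is_minus Q (s : regs Q) := if cur s is Some Minus then true else false.
Definition is_point Q (s : regs Q) := if cur s is Some Point then true else false.

Lemma is_one_bit Q b n f1 f2 (q : Q) : is_one (Regs (Some (bit b)) n f1 f2 q) = b.
Proof. by case: b. Qed.

Section Programs.
Variables (d d' : nat) (M : otm d').
Local Notation T := (tname + tape M)%type.
Local Notation a0 := (aux M).
Local Notation aux := (bool * cell a0)%type.
Local Notation Q := (state M).
Local Notation S := (regs Q).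
Local Notation store := (store T aux).
Local Notation frag := (frag d T aux S).
Local Notation tq := (inl TQ : T).
Local Notation tans := (inl TAns : T).
Variable phi : 'I_d -> nat -> rat.
Local Notation runs := (runs (d := d) (T := T) (aux := aux) tq tans phi).
Implicit Types (s : S) (st : store) (l : seq sym).

Local Notation stk := (stk a0).
Local Notation Pop t := (pop d a0 Q (inl t : T)).
Local Notation Push t f := (push d a0 (inl t : T) f).
Local Notation Setr f := (setr d T a0 f).
Local Notation Pour t t' := (pour d a0 Q (inl t : T) (inl t' : T)).
Local Notation Drain t := (drain d a0 Q (inl t : T)).
Local Notation ForPop t F := (forpop (inl t : T) F).
Local Notation "st '<|' t ':=' l '|>'" := (upd st (inl t : T) (stk l))
  (at level 50, left associativity, t at level 0, l at level 99).
Local Notation clr := (@clr d' M).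
Local Notation src := (src a0).
Local Notation dst := (dst a0).
Local Notation Get t := (get d a0 Q (inl t : T)).
Local Notation Put t f := (put d a0 (inl t : T) f).
Local Notation Skip := (skip d T a0 Q).
Local Notation Simulate := (simulate d M SZ).

(** * Addition and subtraction *)

Definition maj (a b c : bool) := (a && b) || (a && c) || (b && c).

(* Subtraction if [m] and addition otherwise; [fl2] is the borrow or the carry.
   The digits come out reversed on [ST], and [SU] keeps a copy of [SR]. *)
Definition addbit (m : bool) : frag :=
  Push SU (@curv Q) ;;
  Setr (fun s => Regs (cur s) (neg s) (is_one s) (fl2 s) (sta s)) ;;
  Pop SY ;;
  Push SP (fun s => bit (is_one s)) ;;
  Push ST (fun s => bit (fl1 s (+) is_one s (+) fl2 s)) ;;
  Setr (fun s => Regs (cur s) (neg s) (fl1 s) (maj (m (+) fl1 s) (is_one s) (fl2 s)) (sta s)).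

Definition addsub (m : bool) : frag :=
  Setr (fun s => Regs (cur s) (neg s) (fl1 s) false (sta s)) ;;
  ForPop SR (addbit m) ;; Pour SP SY ;;
  Setr (fun s => Regs None (neg s) false (fl2 s) (sta s)).

Lemma runs_addbit m s st a y t u p : st (inl SY) = stk (bits y) ->
  st (inl ST) = stk t -> st (inl SU) = stk u -> st (inl SP) = stk p ->
  runs (addbit m) (setcur (Some (bit a)) s, st) 9
    (Regs (ohead (bits y)) (neg s) a (maj (m (+) a) (head false y) (fl2 s)) (sta s),
     st <| SU := bit a :: u |> <| SY := bits (behead y) |> <| SP := bit (head false y) :: p |>
       <| ST := bit (a (+) head false y (+) fl2 s) :: t |>).
Proof.
move=> sY sT sU sP; apply: runs_to.
- apply: runs_seq; first exact: runs_push sU.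
  apply: runs_seq; first exact: runs_setr.
  apply: runs_seq; first by apply: runs_pop; exact: sY.
  apply: runs_seq; first by apply: runs_push; exact: sP.
  apply: runs_seq; first by apply: runs_push; exact: sT.
  exact: runs_setr.
- by [].
rewrite /= is_one_bit; case: y {sY} => [|b y] /=; first by [].
by rewrite is_one_bit.
Qed.

(** Popping the exhausted [SY] counts as a digit 0, so [y] comes back as [y'], padded with zeros to
    the length of [r]. In the subtraction [c] is the final borrow: the result [z] is the difference
    modulo [2 ^ size r]. *)
Lemma runs_addloop m r y t u p s st : size y <= size r ->
  st (inl SR) = stk (bits r) -> st (inl SY) = stk (bits y) ->
  st (inl ST) = stk t -> st (inl SU) = stk u -> st (inl SP) = stk p ->
  exists z y' (c f : bool), [/\ size z = size r, size y' = size r, bval y' = bval y,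
    if m then bval z + bval y + fl2 s = bval r + c * 2 ^ size r
    else bval z + c * 2 ^ size r = bval r + bval y + fl2 s &
    runs (ForPop SR (addbit m)) (s, st) (11 * size r + 2)
      (Regs None (neg s) f c (sta s),
       st <| SR := [::] |> <| SY := [::] |> <| ST := catrev (bits z) t |>
         <| SU := catrev (bits r) u |> <| SP := catrev (bits y') p |>)].
Proof.
elim: r y t u p s st => [|a r IHr] y t u p s st le_y sR sY sT sU sP.
  case: y le_y sY => // _ sY; exists [::], [::], (fl2 s), (fl1 s); split=> //.
    by case: m; rewrite /= muln1.
  apply: runs_to; first exact: runs_forpop_nil sR.
    by [].
  by rewrite /= !upd_id.
pose b := head false y; pose c := maj (m (+) a) b (fl2 s).
have rA := @runs_addbit m s (st <| SR := bits r |>) a y t u p sY sT sU sP.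
move: rA; rewrite -/b -/c; set s1 := Regs _ _ _ _ _; set st1 := (_ <| ST := _ |>) => rA.
have [||||||z [y' [c' [f [sz sy' vy vz rL]]]]] := IHr (behead y) (bit (a (+) b (+) fl2 s) :: t)
  (bit a :: u) (bit b :: p) s1 st1.
- by rewrite size_behead; move: le_y => /=; lia.
- by [].
- by [].
- by [].
- by [].
- by [].
exists (a (+) b (+) fl2 s :: z), (b :: y'), c', f; split=> /=.
- by rewrite sz.
- by rewrite sy'.
- by rewrite vy /b; case: (y).
(* The identity of a full adder, or of a full subtractor, checked on all values of the digits and
   carries. *)
- have -> : bval y = b + (bval (behead y)).*2 by rewrite /b; case: (y).
  move: vz; rewrite /s1 /= expnS /c; move: (2 ^ _) => e; case: (m).
    by case: (a); case: (b); case: (fl2 s); case: (c'); rewrite /maj /=; lia.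
  by case: (a); case: (b); case: (fl2 s); case: (c'); rewrite /maj /=; lia.
- apply: runs_to; first apply: runs_forpop_cons sR rA rL.
    by lia.
  by congr pair; apply/funext => -[[]|v].
Qed.

Lemma runs_addsub m r y s st : size y <= size r ->
  st (inl SR) = stk (bits r) -> st (inl SY) = stk (bits y) ->
  st (inl ST) = stk [::] -> st (inl SU) = stk [::] -> st (inl SP) = stk [::] ->
  exists z y' (c : bool), [/\ size z = size r, size y' = size r, bval y' = bval y,
    if m then bval z + bval y = bval r + c * 2 ^ size r
    else bval z + c * 2 ^ size r = bval r + bval y &
    runs (addsub m) (s, st) (15 * size r + 6)
      (Regs None (neg s) false c (sta s),
       st <| SR := [::] |> <| SY := bits y' |> <| ST := bits (rev z) |>
         <| SU := bits (rev r) |>)].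
Proof.
move=> le_y sR sY sT sU sP.
have [z [y' [c [f [sz sy' vy vz rL]]]]] :=
  @runs_addloop m r y [::] [::] [::] (Regs (cur s) (neg s) (fl1 s) false (sta s)) st
    le_y sR sY sT sU sP.
exists z, y', c; split=> //; first by move: vz; rewrite !addn0.
apply: runs_to.
- apply: runs_seq; first exact: runs_setr.
  apply: runs_seq; first exact: rL.
  apply: runs_seq; first by apply: runs_pour; [| exact: erefl | exact: erefl].
  exact: runs_setr.
- by rewrite catrevE cats0 size_rev size_map; lia.
congr pair; apply/funext => -[[]|v] //.
- by congr stk; rewrite !catrevE !cats0 revK.
- by congr stk; rewrite catrevE cats0 /bits map_rev.
- by congr stk; rewrite catrevE cats0 /bits map_rev.
Qed.

(** * Long division *)

Definition divstep : frag :=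
  Push SR (@curv Q) ;; addsub true ;;
  condf (@fl2 Q) (Drain ST ;; Pour SU SR ;; Push SQ (fun=> Zero))
                 (Drain SU ;; Pour ST SR ;; Push SQ (fun=> One)) ;;
  Setr clr.

Definition scratch st : Prop :=
  [/\ st (inl ST) = stk [::], st (inl SU) = stk [::] & st (inl SP) = stk [::]].

(** Restoring division: a borrow shows that the divisor does not fit, and the copy kept on [SU] is
    put back. The arithmetic is conditional on [bval r < bval y] but the time bound is not, since
    the machine has to halt for a zero divisor too. *)
Lemma runs_divstep (b : bool) r y q s st : size y <= (size r).+1 ->
  st (inl SR) = stk (bits r) -> st (inl SY) = stk (bits y) -> st (inl SQ) = stk (bits q) ->
  scratch st ->
  exists r' y' (e : bool), [/\ size r' = (size r).+1, size y' = (size r).+1, bval y' = bval y,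
    bval r < bval y -> b + (bval r).*2 = e * bval y + bval r' /\ bval r' < bval y &
    runs divstep (setcur (Some (bit b)) s, st) (22 * size r + 40)
      (clr s, st <| SR := bits r' |> <| SY := bits y' |> <| SQ := bits (e :: q) |>)].
Proof.
move=> le_y sR sY sQ [sT sU sP].
have [z [y' [c [sz sy' vy vz rA]]]] := @runs_addsub true (b :: r) y
  (setcur (Some (bit b)) s) (st <| SR := bits (b :: r) |>) le_y erefl sY sT sU sP.
(* [b :: r] is the shifted remainder, restored after a borrow; otherwise the difference [z] replaces
   it and the quotient digit is 1. *)
exists (if c then b :: r else z), y', (~~ c); split=> //.
- by case: c {vz rA}.
- have := bval_lt z; rewrite sz; move: vz => /=.
  by case: c {rA} => /=; move: (2 ^ _) => e; lia.
case: c rA {vz} => rA.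
  apply: runs_to.
  - apply: runs_seq; first exact: runs_push sR.
    apply: runs_seq; first exact: rA.
    apply: runs_seq.
      apply: runs_cond => /=.
      apply: runs_seq; first by apply: runs_drain; exact: erefl.
      apply: runs_seq; first by apply: runs_pour; [|exact: erefl|exact: erefl].
      by apply: runs_push; exact: sQ.
    exact: runs_setr.
  - by rewrite !size_bits !size_rev sz /=; lia.
  congr pair; apply/funext => -[[]|v] //=.
  by congr stk; rewrite catrev_bits0.
apply: runs_to.
- apply: runs_seq; first exact: runs_push sR.
  apply: runs_seq; first exact: rA.
  apply: runs_seq.
    apply: runs_cond => /=.
    apply: runs_seq; first by apply: runs_drain; exact: erefl.
    apply: runs_seq; first by apply: runs_pour; [|exact: erefl|exact: erefl].
    by apply: runs_push; exact: sQ.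
  exact: runs_setr.
- by rewrite !size_bits !size_rev sz /=; lia.
congr pair; apply/funext => -[[]|v] //=.
by congr stk; rewrite catrev_bits0.
Qed.

Definition divide : frag := ForPop SZ divstep ;; Setr clr.

Lemma runs_divide zs r y q s st : size y <= size r ->
  st (inl SZ) = stk (bits zs) ->
  st (inl SR) = stk (bits r) -> st (inl SY) = stk (bits y) -> st (inl SQ) = stk (bits q) ->
  scratch st ->
  exists r' y' qs, [/\ [/\ size r' = size r + size zs, size y' <= size r + size zs,
      size qs = size zs & bval y' = bval y],
    bval r < bval y -> bval r * 2 ^ size zs + bval (rev zs) = bval (rev qs) * bval y + bval r'
      /\ bval r' < bval y &
    runs divide (s, st) (size zs * (22 * (size r + size zs) + 42) + 3)
      (clr s, st <| SZ := [::] |> <| SR := bits r' |> <| SY := bits y' |>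
         <| SQ := bits (catrev qs q) |>)].
Proof.
move=> le_y sZ sR sY sQ scr.
suff [s' [r' [y' [qs [sc sE vE rL]]]]] : exists s' r' y' qs, [/\ clr s' = clr s,
    [/\ size r' = size r + size zs, size y' <= size r + size zs,
      size qs = size zs & bval y' = bval y],
    bval r < bval y -> bval r * 2 ^ size zs + bval (rev zs) = bval (rev qs) * bval y + bval r'
      /\ bval r' < bval y &
    runs (ForPop SZ divstep) (s, st) (size zs * (22 * (size r + size zs) + 42) + 2)
      (s', st <| SZ := [::] |> <| SR := bits r' |> <| SY := bits y' |>
         <| SQ := bits (catrev qs q) |>)].
  exists r', y', qs; split=> //; apply: runs_to.
  - by apply: runs_seq; [exact: rL | exact: runs_setr].
  - by lia.
  by rewrite sc.
elim: zs r y q s st le_y sZ sR sY sQ scr => [|b zs IH] r y q s st le_y sZ sR sY sQ scr.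
  exists (setcur None s), r, y, [::]; split=> //=.
  - by rewrite !addn0.
  - by rewrite muln1 addn0.
  apply: runs_to; first exact: runs_forpop_nil sZ.
    by [].
  by rewrite /= !upd_id.
have [r1 [y1 [e [sr1 sy1 vy1 vr1 rD]]]] := @runs_divstep b r y q s (st <| SZ := bits zs |>)
  (leq_trans le_y (leqnSn _)) sR sY sQ scr.
have le_y1 : size y1 <= size r1 by rewrite sr1 sy1.
have [|||||s' [r' [y' [qs [sc [sr' sy' sqs vy'] vE rL]]]]] := IH r1 y1 (e :: q) (clr s)
  (st <| SZ := bits zs |> <| SR := bits r1 |> <| SY := bits y1 |> <| SQ := bits (e :: q) |>)
  le_y1; try by [].
exists s', r', y', (e :: qs); split=> /=.
- by rewrite sc.
- by rewrite sr' sqs vy' vy1; split=> //; lia.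
- move=> lt_ry; have [E1 lt1] := vr1 lt_ry; rewrite vy1 in vE; have [E2 lt2] := vE lt1.
  split=> //; rewrite !bval_rev_cons sqs expnS mulnDl.
  move: E1 E2; move: (2 ^ size zs) (bval (rev zs)) (bval (rev qs)) => p V W E1 E2.
  have -> : bval r * (2 * p) + (V + b * p) = (b + (bval r).*2) * p + V by lia.
  by rewrite E1 mulnDl -addnA E2; lia.
apply: runs_to.
- by apply: runs_forpop_cons sZ rD rL.
- by rewrite sr1; move: (size r) (size zs) => m n; nia.
by congr pair; apply/funext => -[[]|v].
Qed.

(** * Multiplication *)

Definition mulstep : frag :=
  condf (@is_one Q)
    (Push SR (fun=> Zero) ;; addsub false ;; Push ST (fun s => bit (fl2 s)) ;;
      Pour ST SR ;; Drain SU ;; Setr clr)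
    (Push SR (fun=> Zero) ;; Setr clr).

Lemma runs_mulstep (e : bool) r y s st : size y <= (size r).+1 ->
  st (inl SR) = stk (bits r) -> st (inl SY) = stk (bits y) -> scratch st ->
  exists r' y', [/\ size r < size r' <= (size r).+2, size y' <= (size r).+1, bval y' = bval y,
    bval r' = (bval r).*2 + e * bval y &
    runs mulstep (setcur (Some (bit e)) s, st) (22 * size r + 42)
      (clr s, st <| SR := bits r' |> <| SY := bits y' |>)].
Proof.
move=> le_y sR sY [sT sU sP]; case: e.
  have [z [y' [c [sz sy' vy vz rA]]]] := @runs_addsub false (false :: r) y
    (setcur (Some (bit true)) s) (st <| SR := bits (false :: r) |>) le_y erefl sY sT sU sP.
  (* The carry out of the addition becomes a new most significant digit, so nothing overflows. *)
  exists (rcons z c), y'; split=> //.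
  - by rewrite size_rcons sz /=; lia.
  - by rewrite sy'.
  - by move: vz; rewrite bval_rcons sz /=; move: (2 ^ _) => p; lia.
  apply: runs_to.
  - apply: runs_cond => /=.
    apply: runs_seq; first exact: runs_push sR.
    apply: runs_seq; first exact: rA.
    apply: runs_seq; first by apply: runs_push; exact: erefl.
    apply: runs_seq; first by apply: runs_pour; [|exact: erefl|exact: erefl].
    apply: runs_seq; first by apply: runs_drain; exact: erefl.
    exact: runs_setr.
  - by rewrite /= !size_bits !size_rev sz /=; lia.
  congr pair; apply/funext => -[[]|v] //=.
  by congr stk; rewrite -[[:: bit c]]/(bits [:: c]) catrev_bits catrevE revK cats1.
exists (false :: r), y; split=> //=; try lia.
apply: runs_to.
- apply: runs_cond => /=.
  apply: runs_seq; first exact: runs_push sR.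
  exact: runs_setr.
- by lia.
by congr pair; apply/funext => -[[]|v].
Qed.

(* Horner's scheme computes [SY] times the number read from [SV]; the fractional
   digits are counted on [SC] to be dropped from the product later. *)
Definition horner_int : frag :=
  loopf (Pop SV) (@is_digit Q) mulstep ;; Setr clr.
Definition horner_frac : frag :=
  ForPop SV (mulstep ;; Push SC (fun=> One)) ;; Setr clr.

Lemma runs_horner_int zs w r y s st : size y <= size r ->
  st (inl SV) = stk (bits zs ++ Point :: w) ->
  st (inl SR) = stk (bits r) -> st (inl SY) = stk (bits y) -> scratch st ->
  exists r' y', [/\ size y' <= size r' <= size r + 2 * size zs, bval y' = bval y,
    bval r' = bval r * 2 ^ size zs + bval (rev zs) * bval y &
    runs horner_int (s, st) (size zs * (22 * (size r + 2 * size zs) + 44) + 3)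
      (clr s, st <| SV := w |> <| SR := bits r' |> <| SY := bits y' |>)].
Proof.
move=> le_y sV sR sY scr.
suff [s' [r' [y' [sc sE vy vr rL]]]] : exists s' r' y', [/\ clr s' = clr s,
    size y' <= size r' <= size r + 2 * size zs, bval y' = bval y,
    bval r' = bval r * 2 ^ size zs + bval (rev zs) * bval y &
    runs (loopf (Pop SV) (@is_digit Q) mulstep) (s, st)
      (size zs * (22 * (size r + 2 * size zs) + 44) + 2)
      (s', st <| SV := w |> <| SR := bits r' |> <| SY := bits y' |>)].
  exists r', y'; split=> //; apply: runs_to.
  - by apply: runs_seq; [exact: rL | exact: runs_setr].
  - by lia.
  by rewrite sc.
elim: zs r y s st le_y sV sR sY scr => [|e zs IH] r y s st le_y sV sR sY scr.
  exists (setcur (Some Point) s), r, y; split=> //=.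
  - by rewrite le_y muln0 addn0 leqnn.
  - by rewrite expn0 muln1 mul0n addn0.
  apply: runs_to; first by apply: runs_loop_stop; [exact: runs_pop sV | exact: erefl].
    by [].
  by congr pair; apply/funext => -[[]|v].
pose st0 := st <| SV := bits zs ++ Point :: w |>.
have [r1 [y1 [sr1 sy1 vy1 vr1 rM]]] := @runs_mulstep e r y s st0
  (leq_trans le_y (leqnSn _)) sR sY scr.
have le_y1 : size y1 <= size r1 by lia.
have [||||s' [r' [y' [sc sE vy' vr' rL]]]] := IH r1 y1 (clr s)
  (st0 <| SR := bits r1 |> <| SY := bits y1 |>) le_y1; try by [].
exists s', r', y'; split=> /=.
- by rewrite sc.
- by lia.
- by rewrite vy'.
- by rewrite vr' vr1 vy1 bval_rev_cons expnS -mul2n; move: (2 ^ _) => p; ring.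
apply: runs_to; first apply: runs_loop_next _ _ rM rL.
- exact: runs_pop sV.
- by case: (e).
- by move: (size r) (size r1) sr1 (size zs) => m m1 sr1 n; nia.
by congr pair; apply/funext => -[[]|v].
Qed.

Lemma runs_horner_frac zs r y s st c : size y <= size r ->
  st (inl SV) = stk (bits zs) -> st (inl SC) = stk c ->
  st (inl SR) = stk (bits r) -> st (inl SY) = stk (bits y) -> scratch st ->
  exists r' y', [/\ size y' <= size r' <= size r + 2 * size zs, bval y' = bval y,
    bval r' = bval r * 2 ^ size zs + bval (rev zs) * bval y &
    runs horner_frac (s, st) (size zs * (22 * (size r + 2 * size zs) + 46) + 3)
      (clr s, st <| SV := [::] |> <| SR := bits r' |> <| SY := bits y' |>
        <| SC := ncons (size zs) One c |>)].
Proof.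
move=> le_y sV sC sR sY scr.
suff [s' [r' [y' [sc sE vy vr rL]]]] : exists s' r' y', [/\ clr s' = clr s,
    size y' <= size r' <= size r + 2 * size zs, bval y' = bval y,
    bval r' = bval r * 2 ^ size zs + bval (rev zs) * bval y &
    runs (ForPop SV (mulstep ;; Push SC (fun=> One))) (s, st)
      (size zs * (22 * (size r + 2 * size zs) + 46) + 2)
      (s', st <| SV := [::] |> <| SR := bits r' |> <| SY := bits y' |>
        <| SC := ncons (size zs) One c |>)].
  exists r', y'; split=> //; apply: runs_to.
  - by apply: runs_seq; [exact: rL | exact: runs_setr].
  - by lia.
  by rewrite sc.
elim: zs r y c s st le_y sV sC sR sY scr => [|e zs IH] r y c s st le_y sV sC sR sY scr.
  exists (setcur None s), r, y; split=> //=.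
  - by rewrite le_y muln0 addn0 leqnn.
  - by rewrite expn0 muln1 mul0n addn0.
  apply: runs_to; first exact: runs_forpop_nil sV.
    by [].
  by rewrite /= !upd_id.
pose st0 := st <| SV := bits zs |>.
have [r1 [y1 [sr1 sy1 vy1 vr1 rM]]] := @runs_mulstep e r y s st0
  (leq_trans le_y (leqnSn _)) sR sY scr.
have le_y1 : size y1 <= size r1 by lia.
have [|||||s' [r' [y' [sc sE vy' vr' rL]]]] := IH r1 y1 (One :: c) (clr s)
  (st0 <| SR := bits r1 |> <| SY := bits y1 |> <| SC := One :: c |>) le_y1; try by [].
exists s', r', y'; split=> /=.
- by rewrite sc.
- by lia.
- by rewrite vy'.
- by rewrite vr' vr1 vy1 bval_rev_cons expnS -mul2n; move: (2 ^ _) => p; ring.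
apply: runs_to; first apply: runs_forpop_cons sV _ rL.
- by apply: runs_seq rM _; apply: runs_push; exact: sC.
- by move: (size r) (size r1) sr1 (size zs) => m m1 sr1 n; nia.
congr pair; apply/funext => -[[]|v] //=.
by congr stk; elim: (size zs) => //= n ->.
Qed.

(** * Signs and the normal form of dyadic numerals *)

Definition signf : frag :=
  Pop SV ;; condf (@is_minus Q) (Setr (fun s => Regs None true false false (sta s)))
    (Push SV (@curv Q) ;; Setr (fun s => Regs None false false false (sta s))).

Lemma runs_signf (b : bool) x w s st :
  st (inl SV) = stk (nseq b Minus ++ bit x :: w) ->
  runs signf (s, st) 5 (Regs None b false false (sta s), st <| SV := bit x :: w |>).
Proof.
case: b => sV; apply: runs_to.
- apply: runs_seq; first by apply: runs_pop; exact: sV.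
  by apply: runs_cond => /=; exact: runs_setr.
- by [].
- by [].
- apply: runs_seq; first by apply: runs_pop; exact: sV.
  apply: runs_cond; rewrite [is_minus _](_ : _ = false); last by case: (x).
  apply: runs_seq; first by apply: runs_push; exact: erefl.
  exact: runs_setr.
- by [].
by congr pair; apply/funext => -[[]|v].
Qed.

(** The flag [fl1] is raised by the first digit 1. Zeros met before it are trailing zeros of the
    fraction and are not copied. *)
Definition fracbit : frag :=
  Pop SQ ;;
  Setr (fun s => Regs (cur s) (neg s) (fl1 s || is_one s) (fl2 s) (sta s)) ;;
  condf (@fl1 Q) (Push SW (fun s => bit (is_one s))) Skip.

Lemma runs_fracbit q w s st : st (inl SQ) = stk (bits q) -> st (inl SW) = stk w ->
  let b := odd (bval q) in
  runs fracbit (s, st) 5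
    (Regs (ohead (bits q)) (neg s) (fl1 s || b) (fl2 s) (sta s),
     st <| SQ := bits (behead q) |> <| SW := if fl1 s || b then bit b :: w else w |>).
Proof.
move=> sQ sW b.
have oneE : is_one (setcur (ohead (bits q)) s) = b.
  rewrite /b; case: q {sQ b} => [|[] q] //=; first by rewrite oddD odd_double.
  by rewrite add0n odd_double.
have oneE' f : is_one (Regs (ohead (bits q)) (neg s) f (fl2 s) (sta s)) = b.
  by rewrite -oneE.
pose s1 := Regs (ohead (bits q)) (neg s) (fl1 s || b) (fl2 s) (sta s).
pose st1 := st <| SQ := bits (behead q) |>.
have rC : runs (condf (@fl1 Q) (Push SW (fun s => bit (is_one s))) Skip) (s1, st1) 3
    (s1, st1 <| SW := if fl1 s || b then bit b :: w else w |>).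
  apply: runs_cond; rewrite /=; case E: (fl1 s || b).
    by rewrite -(oneE' (fl1 s || b)); apply: runs_push.
  apply: runs_to; first exact: runs_setr.
    by [].
  by rewrite upd_id.
apply: runs_to.
- apply: runs_seq; first by apply: runs_pop; exact: sQ.
  apply: runs_seq; first exact: runs_setr.
  by rewrite /= oneE /bits behead_map; exact: rC.
- by [].
by [].
Qed.

Section Normalization.
Variable kc : tname.
Hypothesis kcE : kc = SC \/ kc = SD.

Lemma bval_behead q : bval (behead q) = (bval q)./2.
Proof. by case: q => //= b q; rewrite half_bit_double. Qed.

Lemma runs_frac_on c q w s st : fl1 s ->
  st (inl kc) = stk c -> st (inl SQ) = stk (bits q) -> st (inl SW) = stk w ->
  exists q', [/\ size q' <= size q, bval q' = bval q %/ 2 ^ size c &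
    runs (ForPop kc fracbit) (s, st) (7 * size c + 2)
      (Regs None (neg s) true (fl2 s) (sta s),
       st <| kc := [::] |> <| SQ := bits q' |> <| SW := digits (bval q) (size c) ++ w |>)].
Proof.
elim: c q w s st => [|a c IH] q w s st fs sk sQ sW.
  exists q; rewrite divn1; split=> //; apply: runs_to; first exact: runs_forpop_nil sk.
    by [].
  by rewrite /= !upd_id // /setcur fs.
rewrite (digitsS (bval q) (size c)) cat_rcons.
have [sQ1 sW1] : (st <| kc := c |>) (inl SQ) = stk (bits q) /\ (st <| kc := c |>) (inl SW) = stk w.
  by case: kcE => ->.
have := runs_fracbit (setcur (Some a) s) sQ1 sW1; cbv zeta; rewrite /= fs /=.
set s1 := Regs _ _ _ _ _; set st1 := (_ <| SW := _ |>) => rF.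
have [||||q' [sq' vq' rL]] := IH (behead q) (bit (odd (bval q)) :: w) s1 st1; try by [].
  by rewrite /st1; case: kcE => ->.
exists q'; split.
- by apply: leq_trans sq' _; rewrite size_behead leq_pred.
- by rewrite vq' bval_behead -divn2 -divnMA /= expnS.
apply: runs_to; first exact: runs_forpop_cons sk rF rL.
  by rewrite /=; lia.
rewrite bval_behead.
by congr pair; apply/funext; rewrite /st1; case: kcE => -> -[[]|v].
Qed.

Lemma runs_frac c q s st : fl1 s = false ->
  st (inl kc) = stk c -> st (inl SQ) = stk (bits q) -> st (inl SW) = stk [::] ->
  exists q' V j, [/\ size q' <= size q, (j == 0) || odd V,
    bval q' = V %/ 2 ^ j /\ (forall b, dy b (bval q) (size c) = dy b V j) &
    runs (ForPop kc fracbit) (s, st) (7 * size c + 2)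
      (Regs None (neg s) (j != 0) (fl2 s) (sta s),
       st <| kc := [::] |> <| SQ := bits q' |> <| SW := digits V j |>)].
Proof.
elim: c q s st => [|a c IH] q s st fs sk sQ sW.
  exists q, (bval q), 0; rewrite divn1; split=> //; apply: runs_to; first exact: runs_forpop_nil sk.
    by [].
  by rewrite /= !upd_id // /setcur fs.
have [sQ1 sW1] : (st <| kc := c |>) (inl SQ) = stk (bits q) /\ (st <| kc := c |>) (inl SW) = stk [::].
  by case: kcE => ->.
have := runs_fracbit (setcur (Some a) s) sQ1 sW1; cbv zeta; rewrite /= fs /=.
set s1 := Regs _ _ _ _ _; set st1 := (_ <| SW := _ |>) => rF.
have sk1 : st1 (inl kc) = stk c by rewrite /st1; case: kcE => ->.
(* An odd numerator means that the fraction is already reduced, and all remaining digits are kept;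
   an even one is halved together with the denominator. *)
case oq: (odd (bval q)) in s1 st1 rF sk1.
  have [||||q' [sq' vq' rL]] := @runs_frac_on c (behead q) [:: One] s1 st1; try by [].
  exists q', (bval q), (size c).+1; split.
  - by apply: leq_trans sq' _; rewrite size_behead leq_pred.
  - by rewrite oq.
  - by rewrite vq' bval_behead -divn2 -divnMA /= expnS.
  apply: runs_to; first exact: runs_forpop_cons sk rF rL.
    by rewrite /=; lia.
  rewrite bval_behead (digitsS (bval q) (size c)) oq -cats1.
  by congr pair; apply/funext; rewrite /st1; case: kcE => -> -[[]|v].
have [||||q' [V [j [sq' jV [vq' dyE] rL]]]] := IH (behead q) s1 st1; try by [].
exists q', V, j; split=> //.
- by apply: leq_trans sq' _; rewrite size_behead leq_pred.
- split=> // b; rewrite -dyE bval_behead -[in LHS](even_halfK (n := bval q)) ?oq //.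
  exact: dy_double.
apply: runs_to; first exact: runs_forpop_cons sk rF rL.
  by rewrite /=; lia.
by congr pair; apply/funext; rewrite /st1; case: kcE => -> -[[]|v].
Qed.

(** Besides copying, this keeps in [fl1] whether some digit 1 has been met, that is, whether the
    number is nonzero: zero is printed without sign. *)
Definition intbits : frag := ForPop SQ
  (Push SW (@curv Q) ;;
   Setr (fun s => Regs (cur s) (neg s) (fl1 s || is_one s) (fl2 s) (sta s))).

Lemma runs_intbits q w s st : st (inl SQ) = stk (bits q) -> st (inl SW) = stk w ->
  runs intbits (s, st) (5 * size q + 2)
    (Regs None (neg s) (fl1 s || (bval q != 0)) (fl2 s) (sta s),
     st <| SQ := [::] |> <| SW := catrev (bits q) w |>).
Proof.
elim: q w s st => [|b q IH] w s st sQ sW.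
  apply: runs_to; first exact: runs_forpop_nil sQ.
    by [].
  by rewrite /= !upd_id // /setcur orbF.
apply: runs_to; first apply: runs_forpop_cons sQ _ _.
- apply: runs_seq; first by apply: runs_push; exact: sW.
  exact: runs_setr.
- by apply: IH; exact: erefl.
- by rewrite /=; lia.
congr pair; last by apply/funext => -[[]|v].
rewrite /= is_one_bit -orbA; congr (Regs _ _ (_ || _) _ _).
by case: (b) => //=; rewrite -double0 (inj_eq double_inj).
Qed.

Definition strip : frag :=
  loopf (Pop SW) (@is_zero Q) Skip ;;
  condf (@is_point Q) (Push SW (fun=> Point) ;; Push SW (fun=> Zero)) (Push SW (@curv Q)) ;;
  Setr (setcur None).

Lemma runs_strip zs w s st : st (inl SW) = stk (bits zs ++ Point :: w) ->
  runs strip (s, st) (3 * size zs + 8)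
    (setcur None s, st <| SW := bin (bval (rev zs)) ++ Point :: w |>).
Proof.
move=> sW.
(* Popping stops either at the point, when the integer part is 0 and a single zero has to be put
   back, or at the leading 1. *)
suff [a [v [rL aE]]] : exists a v,
    runs (loopf (Pop SW) (@is_zero Q) Skip) (s, st) (3 * size zs + 2)
      (setcur (Some a) s, st <| SW := v |>) /\
    ((a = Point /\ v = w /\ bin (bval (rev zs)) = [:: Zero]) \/
     exists t, a = One /\ v = t ++ Point :: w /\ bin (bval (rev zs)) = One :: t).
  case: aE => [[aE [vE ->]]|[t [aE [vE ->]]]]; subst a v; apply: runs_to.
  - apply: runs_seq; first exact: rL.
    apply: runs_seq.
      apply: runs_cond => /=; apply: runs_seq; first by apply: runs_push; exact: erefl.
      by apply: runs_push; exact: erefl.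
    exact: runs_setr.
  - by lia.
  - by congr pair; apply/funext => -[[]|v].
  - apply: runs_seq; first exact: rL.
    apply: runs_seq; first by apply: runs_cond => /=; apply: runs_push; exact: erefl.
    exact: runs_setr.
  - by lia.
  by congr pair; apply/funext => -[[]|v].
elim: zs s st sW => [|[] zs IH] s st sW.
- exists Point, w; split; last by left; rewrite bin0.
  by apply: runs_loop_stop; [exact: runs_pop sW | exact: erefl].
- exists One, (bits zs ++ Point :: w); split; last first.
    by right; exists (bits zs); rewrite rev_cons bin_bval -rev_cons revK.
  apply: runs_le; last by apply: runs_loop_stop; [exact: runs_pop sW | exact: erefl].
  by lia.
have [|a [v [rL aE]]] := IH (setcur (Some Zero) s) (st <| SW := bits zs ++ Point :: w |>).
  by [].
exists a, v; split; last by rewrite bval_rev_cons addn0.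
apply: runs_to; first apply: runs_loop_next _ _ _ rL.
- exact: runs_pop sW.
- by [].
- exact: runs_setr.
- by rewrite /=; lia.
by congr pair; apply/funext => -[[]|u].
Qed.

(* Prints in normal form the number on [SQ] divided by 2 to the length of the
   counter [kc], with sign [neg]: trailing zeros are skipped while the counter
   lasts, leading ones are removed from the top of [SW] afterwards. *)
Definition normalize : frag :=
  Setr (fun s => Regs (cur s) (neg s) false false (sta s)) ;;
  ForPop kc fracbit ;; Push SW (fun=> Point) ;; intbits ;; strip ;;
  condf (fun s => neg s && fl1 s) (Push SW (fun=> Minus)) Skip ;; Setr clr.

Lemma runs_normalize c q s st :
  st (inl kc) = stk c -> st (inl SQ) = stk (bits q) -> st (inl SW) = stk [::] ->
  runs normalize (s, st) (7 * size c + 8 * size q + 20)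
    (clr s, st <| kc := [::] |> <| SQ := [::] |>
      <| SW := enc_dyadic (dy (neg s) (bval q) (size c)) |>).
Proof.
move=> sk sQ sW.
have [q' [V [j [sq' jV [vq' dyE] rL]]]] := @runs_frac c q
  (Regs (cur s) (neg s) false false (sta s)) st erefl sk sQ sW.
rewrite dyE enc_dy //.
(* The flag collected by the two loops detects zero: for [j != 0] the numerator is odd, and for
   [j = 0] the integer part is all of [V]. *)
have ne0 : (j != 0) || (bval q' != 0) = (V != 0).
  rewrite vq'; case: eqP jV => [->|_] /=; first by rewrite divn1.
  by case: (V).
have [l El [sl _]] := bits_digits V j.
have E : catrev (bits q') (Point :: digits V j) = bits (rev q') ++ Point :: digits V j.
  by rewrite catrevE /bits map_rev.
apply: runs_to.
- apply: runs_seq; first exact: runs_setr.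
  apply: runs_seq; first exact: rL.
  apply: runs_seq; first by apply: runs_push; exact: erefl.
  apply: runs_seq; first by apply: runs_intbits; exact: erefl.
  rewrite /= E ne0.
  apply: runs_seq; first by apply: runs_strip; exact: erefl.
  apply: runs_seq; first apply: runs_cond => /=.
    instantiate (2 := 2); instantiate (1 := (Regs None (neg s) (V != 0) false (sta s),
      st <| kc := [::] |> <| SQ := [::] |> <| SW := nseq (neg s && (V != 0)) Minus ++
        bin (V %/ 2 ^ j) ++ Point :: digits V j |>)).
    rewrite revK vq'; case: (neg s && (V != 0)).
      apply: runs_to; [by apply: runs_push; exact: erefl | by [] |].
      by congr pair; apply/funext; case: kcE => -> -[[]|v].
    apply: runs_to; [exact: runs_setr | by [] |].
    by congr pair; apply/funext; case: kcE => -> -[[]|v].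
  exact: runs_setr.
- by rewrite size_rev; lia.
by [].
Qed.

End Normalization.

(** * Reading numerals and writing the output *)

Definition setneg b s : S := Regs (cur s) b (fl1 s) (fl2 s) (sta s).

Definition signin (t : tname) : frag :=
  Get t ;; condf (@is_minus Q) (Setr (setneg true) ;; Get t) (Setr (setneg false)).

Lemma runs_signin t h (b : bool) x w s st : st (inl t) = src h (nseq b Minus ++ bit x :: w) ->
  runs (signin t) (s, st) 4 (Regs (Some (bit x)) b (fl1 s) (fl2 s) (sta s),
    upd st (inl t) (src (b + h.+1) w)).
Proof.
case: b => stt; apply: runs_to.
- apply: runs_seq; first exact: runs_get stt.
  apply: runs_cond => /=; apply: runs_seq; first exact: runs_setr.
  by apply: runs_get; exact: upd_same.
- by [].
- by rewrite /= upd_upd.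
- apply: runs_seq; first exact: runs_get stt.
  apply: runs_cond; rewrite [is_minus _](_ : _ = false); last by case: (x).
  exact: runs_setr.
- by [].
by [].
Qed.

Definition digitsin (t : tname) (F : frag) : frag :=
  loopf Skip (@is_digit Q) (F ;; Get t).

(* [P c] is the store after the digits [c] have been read, the last one first. *)
Lemma runs_digitsin t F n (P : seq bool -> store) w :
  (forall b c s x, cur s = Some (bit b) ->
     runs F (s, upd (P c) (inl t) x) n (s, upd (P (b :: c)) (inl t) x)) ->
  is_digit (setcur (ohead w) (Regs None false false false (start M))) = false ->
  forall zs c h f0 f1 f2 q,
  runs (digitsin t F)
    (Regs (ohead (bits zs ++ w)) f0 f1 f2 q, upd (P c) (inl t) (src h (behead (bits zs ++ w))))
    (size zs * (n + 3) + 2)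
    (Regs (ohead w) f0 f1 f2 q, upd (P (catrev zs c)) (inl t) (src (h + size zs) (behead w))).
Proof.
move=> runF ndw; elim=> [|b zs IH] c h f0 f1 f2 q.
  rewrite addn0; apply: runs_to; first by apply: runs_loop_stop; [exact: runs_setr | exact: ndw].
    by [].
  by [].
apply: runs_to; first apply: runs_loop_next _ _ _ (IH (b :: c) h.+1 f0 f1 f2 q).
- exact: runs_setr.
- by case: (b).
- apply: runs_seq; first by apply: runF.
  have := @runs_get d T a0 Q (inl TQ) (inl TAns) phi (inl t) h (bits zs ++ w)
    (Regs (Some (bit b)) f0 f1 f2 q) (upd (P (b :: c)) (inl t) (src h (bits zs ++ w)))
    (upd_same _ _ _).
  rewrite upd_upd; exact.
- by rewrite /=; lia.
by rewrite addSnnS.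
Qed.

Lemma runs_repf n F (P : nat -> store) s k m :
  (forall j, runs F (s, P j) n (s, P j.+1)) ->
  runs (repf k F) (s, P m) (k * n + 1) (s, P (m + k)).
Proof.
move=> runF; elim: k m => [|k IH] m.
  by rewrite addn0; apply: runs_to; first exact: runs_setr.
apply: runs_to; first by apply: runs_seq; [exact: runF | exact: IH].
  by lia.
by rewrite addSnnS.
Qed.

Definition emit (keep : S -> bool) : frag :=
  ForPop SW (condf keep (Put TOut (@curv Q)) Skip).

Lemma runs_emit (keep : pred sym) w v s st :
  st (inl SW) = stk w -> st (inl TOut) = dst v ->
  runs (emit (fun s => keep (curv s))) (s, st) (4 * size w + 2)
    (setcur None s, upd (st <| SW := [::] |>) (inl TOut : T) (dst (v ++ filter keep w))).
Proof.
elim: w v s st => [|a w IH] v s st sW sO.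
  apply: runs_to; first exact: runs_forpop_nil sW.
    by [].
  by congr pair; apply/funext => -[[]|u] //=; rewrite /upd /= cats0.
apply: runs_to.
- apply: runs_forpop_cons sW _ _.
    instantiate (2 := 2); instantiate (1 := (setcur (Some a) s,
      upd (st <| SW := w |>) (inl TOut : T) (dst (if keep a then rcons v a else v)))).
    apply: runs_cond => /=; rewrite /curv /=; case: (keep a).
      apply: runs_to; [by apply: runs_put; exact: sO | by [] |].
      by [].
    apply: runs_to; [exact: runs_setr | by [] |].
    by congr pair; apply/funext => -[[]|u].
  by apply: IH; exact: erefl.
- by rewrite /=; lia.
congr pair; apply/funext => -[[]|u] //=.
by congr dst; case: (keep a); rewrite ?cat_rcons.
Qed.

(** * Initial tapes, and the machine of a definable function *)

Lemma blank_stk : blank aux = stk [::].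
Proof. by rewrite /blank /stk; congr pair; apply/funext => -[|i] //=; rewrite /wordf nth_nil. Qed.

Lemma blank_dst : blank aux = dst [::].
Proof. by rewrite /blank /dst; congr pair; apply/funext => i; rewrite /wordf nth_nil. Qed.

Lemma src0 w : (wordf aux w, 0) = src 0 w.
Proof. by rewrite /src; congr pair; apply/funext => i; rewrite subn0. Qed.

(* Fractional digits are read as long as the counter [SC] lasts. *)
Definition fracin : frag := ForPop SC (Get TAns ;; Push SQ (fun s => bit (is_one s))).

(** Shifts the binary point by [n] places: [n] digits of [v], completed by zeros, are pushed on the
    integer part. An oracle may answer with arbitrarily many fractional digits, so the time must not
    depend on the length of [v]. *)
Fixpoint fetch (n : nat) (v q : seq bool) : seq bool :=
  if n is n'.+1 then fetch n' (behead v) (head false v :: q) else q.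

Lemma runs_fracin c v q h s st :
  st (inl SC) = stk c -> st (inl TAns) = src h (bits v) -> st (inl SQ) = stk (bits q) ->
  exists x, runs fracin (s, st) (5 * size c + 2)
    (setcur None s, upd (st <| SC := [::] |> <| SQ := bits (fetch (size c) v q) |>)
      (inl TAns : T) x).
Proof.
elim: c v q h s st => [|a c IH] v q h s st sC sA sQ.
  exists (st (inl TAns)); apply: runs_to; first exact: runs_forpop_nil sC.
    by [].
  by congr pair; apply/funext => -[[]|u].
pose b := head false v.
have [|||x rL] := IH (behead v) (b :: q) h.+1 (setcur (ohead (bits v)) s)
  (upd (st <| SC := c |> <| SQ := bits (b :: q) |>) (inl TAns : T) (src h.+1 (bits (behead v)))); try by [].
exists x; apply: runs_to.
- apply: runs_forpop_cons sC _ rL.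
  apply: runs_seq; first by apply: runs_get; exact: sA.
  apply: runs_to; [by apply: runs_push; exact: sQ | exact: leqnn |].
  have -> : is_one (setcur (ohead (bits v)) (setcur (Some a) s)) = b by rewrite /b; case: (v) => [|[]].
  rewrite /bits behead_map -/(bits _).
  by congr pair; apply/funext => -[[]|u].
- by rewrite /=; lia.
by congr pair; apply/funext => -[[]|u].
Qed.

Lemma fetch_bval n v u : exists2 r, r < 2 ^ size v & exists2 e,
  bval (fetch n v (rev u)) * 2 ^ size v + e = bval (rev (u ++ v)) * 2 ^ n & e < 2 ^ size v * 2 ^ n.
Proof. Abort.

Definition initial w : store := fun t => if t == inl TIn then src 0 w else blank aux.

Lemma size_fetch n v q : size (fetch n v q) = n + size q.
Proof. by elim: n v q => //= n IH v q; rewrite IH addnS. Qed.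

Lemma fetch_bval n v u : let X := bval (fetch n v (rev u)) in
  X * 2 ^ size v <= bval (rev (u ++ v)) * 2 ^ n < X.+1 * 2 ^ size v.
Proof.
elim: n v u => [|n IH] v u /=.
  rewrite rev_cat bval_cat muln1 size_rev.
  by have := bval_lt (rev v); rewrite size_rev; lia.
case: v => [|b v] /=.
  have := IH [::] (rcons u false); rewrite !cats0 rev_rcons /= add0n expnS -muln2.
  by rewrite -mulnA.
have := IH v (rcons u b); rewrite rev_rcons cat_rcons /= !expnS.
by move: (2 ^ n) (2 ^ size v) (bval _) (bval _) => p r X W; nia.
Qed.

(** One unit of [m = n + c] is recorded four times: in the question, as a fractional digit to be
    read ([SC]), as a place by which the answer will be shifted ([SD]), and as a zero of the numeral
    of [2 ^ m] ([SX]). *)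
Definition ones : frag := Put TQ (fun=> One) ;; Push SC (fun=> One) ;;
  Push SD (fun=> One) ;; Push SX (fun=> Zero).

Definition counted st k : store :=
  upd (st <| SC := nseq k One |> <| SD := nseq k One |> <| SX := nseq k Zero ++ [:: Point] |>)
    (inl TQ : T) (dst (nseq k One)).

Lemma runs_ones st k s : runs ones (s, counted st k) 7 (s, counted st k.+1).
Proof.
apply: runs_to.
- apply: runs_seq; first by apply: runs_put; exact: erefl.
  apply: runs_seq; first by apply: runs_push; exact: erefl.
  apply: runs_seq; first by apply: runs_push; exact: erefl.
  by apply: runs_push; exact: erefl.
- by [].
congr pair; apply/funext => -[[]|u] //.
by congr dst; rewrite -cats1 -[[:: One]]/(nseq 1 One) -nseqD addn1.
Qed.

Definition readn : frag := loopf (Get TIn) (fun s => isSome (cur s)) ones.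

Lemma runs_readn st n h k s :
  runs readn (s, counted (upd st (inl TIn : T) (src h (nseq n One))) k) (9 * n + 2)
    (setcur None s, counted (upd st (inl TIn : T) (src (h + n).+1 [::])) (k + n)).
Proof.
elim: n h k s => [|n IH] h k s.
  rewrite !addn0; apply: runs_loop_stop; last exact: erefl.
  apply: runs_to; [by apply: runs_get; exact: erefl | by [] |].
  by congr pair; apply/funext => -[[]|u].
apply: runs_to; first apply: runs_loop_next _ _ _ (IH h.+1 k.+1 (setcur (Some One) s)).
- by apply: runs_get; exact: erefl.
- by [].
- apply: runs_to; [|exact: leqnn|].
    have := runs_ones (upd st (inl TIn : T) (src h.+1 (nseq n One))) k (setcur (Some One) s).
    rewrite [counted _ k](_ : _ = upd (counted (upd st (inl TIn : T) (src h (nseq n.+1 One))) k)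
      (inl TIn : T) (src h.+1 (nseq n One))).
      exact.
    by apply/funext => -[[]|u].
  by [].
- by rewrite mulnS; lia.
by rewrite !addSnnS.
Qed.

Definition askA (i0 : 'I_d) (c : nat) : frag :=
  Push SX (fun=> Point) ;; readn ;; repf c ones ;; Push SX (fun=> One) ;; consult T aux S i0 ;;
  signin TAns.

(* Puts the oracle words [X.] and [2 ^ (n + c).] on [SW] and [SX]. *)
Definition prologueA (i0 : 'I_d) (c : nat) : frag :=
  askA i0 c ;; digitsin TAns (Push SQ (@curv Q)) ;; fracin ;; normalize SC.

Lemma runs_askA i0 c n (b : bool) u0 u s :
  enc_dyadic (phi i0 (n + c)) = nseq b Minus ++ bit u0 :: u ->
  runs (askA i0 c) (s, initial (nseq n One)) (9 * n + 7 * c + 20)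
    (Regs (Some (bit u0)) b (fl1 s) (fl2 s) (sta s),
     upd (counted (upd (initial (nseq n One)) (inl TIn : T) (src n.+1 [::])) (n + c) <|
       SX := One :: nseq (n + c) Zero ++ [:: Point] |>) (inl TAns : T) (src (b + 1) u)).
Proof.
move=> encE; apply: runs_to.
- apply: runs_seq; first by apply: runs_push; exact: blank_stk.
  rewrite [X in runs _ (s, X)](_ : _ = counted (upd (initial (nseq n One)) (inl TIn : T)
    (src 0 (nseq n One))) 0); last first.
    by apply/funext => -[[]|t] //; first [exact: blank_stk | exact: blank_dst].
  apply: runs_seq; first exact: runs_readn.
  apply: runs_seq; first by apply: runs_repf => j; exact: runs_ones.
  apply: runs_seq; first by apply: runs_push; exact: erefl.
  apply: runs_seq.
    by apply: (@runs_consult _ _ _ _ _ _ _ _ _ _ (nseq (n + c) One)).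
  rewrite size_nseq encE src0.
  by apply: (runs_signin (h := 0) (x := u0) (w := u)).
- by lia.
by congr pair; apply/funext => -[[]|t].
Qed.

Lemma runs_prologueA i0 c n (b : bool) u v s :
  enc_dyadic (phi i0 (n + c)) = nseq b Minus ++ bits u ++ Point :: bits v -> 0 < size u ->
  exists st, [/\ runs (prologueA i0 c) (s, initial (nseq n One)) (50 * (n + c + size u + 1))
      (Regs None b false false (sta s), st),
    [/\ st (inl SW) = stk (enc_dyadic (dy b (bval (fetch (n + c) v (rev u))) 0)),
      st (inl SX) = stk (One :: nseq (n + c) Zero ++ [:: Point]) &
      st (inl SD) = stk (nseq (n + c) One)],
    [/\ st (inl SN) = stk [::], st (inl SV) = stk [::], st (inl SZ) = stk [::],
      st (inl SQ) = stk [::] & st (inl TOut) = dst [::]] &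
    forall t, st (inr t) = blank aux].
Proof.
move=> encE; case: u encE => // u0 u encE _.
set m := n + c in encE *.
have kcE : SC = SC \/ SC = SD by left.
pose st1 := counted (upd (initial (nseq n One)) (inl TIn : T) (src n.+1 [::])) m <|
  SX := One :: nseq m Zero ++ [:: Point] |>.
pose P q := st1 <| SQ := bits q |>.
have rA := runs_askA s encE; rewrite -/m in rA.
rewrite [upd _ _ (src _ _)](_ : _ = upd (P [::]) (inl TAns : T)
   (src (b + 1) (bits u ++ Point :: bits v))) in rA; last first.
  by apply/funext => -[[]|t] //; exact: blank_stk.
have runF e q s' x : cur s' = Some (bit e) -> runs (Push SQ (@curv Q))
    (s', upd (P q) (inl TAns : T) x) 2 (s', upd (P (e :: q)) (inl TAns : T) x).
  move=> se; apply: runs_to; [by apply: runs_push; exact: erefl | by [] |].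
  by rewrite /curv se /=; congr pair; apply/funext => -[[]|t].
have rD := runs_digitsin runF (w := Point :: bits v) erefl (u0 :: u) [::] (b + 1) b (fl1 s) (fl2 s) (sta s).
have [||x rF] := @runs_fracin (nseq m One) v (catrev (u0 :: u) [::])
  (b + 1 + size (u0 :: u)) (Regs (Some Point) b (fl1 s) (fl2 s) (sta s))
  (upd (P (catrev (u0 :: u) [::])) (inl TAns : T)
     (src (b + 1 + size (u0 :: u)) (bits v))) erefl; try by [].
rewrite size_nseq in rF.
eexists; split.
- apply: runs_to.
  + apply: runs_seq; first exact: rA.
    apply: runs_seq; first exact: rD.
    apply: runs_seq; first exact: rF.
    (* The counter [SC] has been used up by [fracin], so that an integer is printed. *)
    by apply: (runs_normalize kcE); [exact: erefl | exact: erefl | exact: blank_stk].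
  + by rewrite /= size_fetch catrevE size_cat size_rev /=; lia.
  by [].
- by split; rewrite ?catrevE ?cats0.
- by split; first [exact: erefl | exact: blank_stk | exact: blank_dst].
by [].
Qed.

(** Reading stops at the point. Dropping the fraction of the answer costs at most 1 before the
    shift, and leaves the counter [SD] as the only denominator. *)
Definition epilogueA : frag :=
  Drain SW ;; signf ;; (loopf (Pop SV) (@is_digit Q) (Push SQ (@curv Q))) ;;
  normalize SD ;; emit (fun=> true).

Lemma runs_epilogueA m (b : bool) u v w s st : 0 < size u ->
  st (inl SW) = stk w -> st (inl SV) = stk (nseq b Minus ++ bits u ++ Point :: v) ->
  st (inl SD) = stk (nseq m One) -> st (inl SQ) = stk [::] -> st (inl TOut) = dst [::] ->
  exists s' st', runs epilogueA (s, st) (3 * size w + 20 * (m + size u) + 100) (s', st') /\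
    st' (inl TOut) = dst (enc_dyadic (dy b (bval (rev u)) m)).
Proof.
case: u => // u0 u _ sW sV sD sQ sO.
have kcE : SD = SC \/ SD = SD by right.
have rL : forall zs q s st, st (inl SV) = stk (bits zs ++ Point :: v) -> st (inl SQ) = stk (bits q) ->
    runs (loopf (Pop SV) (@is_digit Q) (Push SQ (@curv Q))) (s, st) (4 * size zs + 2)
      (setcur (Some Point) s, st <| SV := v |> <| SQ := bits (catrev zs q) |>).
  elim=> [|e zs IH] q s' st' sV' sQ'.
    apply: runs_to; first by apply: runs_loop_stop; [exact: runs_pop sV' | exact: erefl].
      by [].
    by congr pair; apply/funext => -[[]|t].
  apply: runs_to; first apply: runs_loop_next _ _ _ (IH (e :: q) (setcur (Some (bit e)) s') _ _ _).
  - exact: runs_pop sV'.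
  - by case: (e).
  - by apply: runs_push; exact: sQ'.
  - exact: erefl.
  - exact: erefl.
  - by rewrite /=; lia.
  by congr pair; apply/funext => -[[]|t].
eexists _, _; split.
  apply: runs_to.
  - apply: runs_seq; first by apply: runs_drain; exact: sW.
    apply: runs_seq; first by apply: (runs_signf (x := u0) (w := bits u ++ Point :: v)); exact: sV.
    apply: runs_seq; first by apply: (rL (u0 :: u) [::]); [exact: erefl | exact: sQ].
    apply: runs_seq; first by apply: (runs_normalize kcE); [exact: sD | exact: erefl | exact: erefl].
    by apply: (@runs_emit predT _ [::]); [exact: erefl | exact: sO].
  - rewrite size_nseq; set e := enc_dyadic _.
    have := size_enc_dy b (catrev (u0 :: u) [::]) m; rewrite -/e catrevE cats0 size_rev /=.
    by lia.
  by [].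
by rewrite upd_same size_nseq filter_predT catrevE cats0.
Qed.

Definition programA (i0 : 'I_d) (c : nat) : frag :=
  prologueA i0 c ;; Simulate SW SX SN SV ;; epilogueA.

(** The empty input of the simulated machine is precision 0 in unary, that is, an error of at most
    1. Its two oracles answer the integer [X] and the power [2 ^ (n + c)]. *)
Lemma runs_programA i0 (psi : 'I_d' -> nat -> rat) c n (b b' : bool) u v u' v' t s w0 w1 :
  enc_dyadic (phi i0 (n + c)) = nseq b Minus ++ bits u ++ Point :: bits v -> 0 < size u ->
  w0 = enc_dyadic (dy b (bval (fetch (n + c) v (rev u))) 0) ->
  w1 = One :: nseq (n + c) Zero ++ [:: Point] ->
  (forall i m, enc_dyadic (psi i m) = if i == 0 :> nat then w0 else w1) ->
  halted (run M psi [::] t) -> outputs (run M psi [::] t) (nseq b' Minus ++ bits u' ++ Point :: v') ->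
  0 < size u' ->
  let B := n + c + size u + t + 1 in
  exists s' st', runs (programA i0 c) (s, initial (nseq n One)) (120 * 100 * B * B) (s', st') /\
    st' (inl TOut) = dst (enc_dyadic (dy b' (bval (rev u')) (n + c))).
Proof.
move=> encE u_gt0 w0E w1E psiE ht outt u'_gt0 B.
have [st1 [r1 [sW sX sD] [sN sV sZ sQ sO] stu]] := runs_prologueA s encE u_gt0.
rewrite -w0E in sW; rewrite -w1E in sX.
have [le_v [st2 [r2 sV2 st2E]]] := @runs_simulate d d' tname M (inl TQ) (inl TAns) phi SZ SW SX
  isT isT psi w0 w1 psiE SN SV [::] t _ (Regs None b false false (sta s)) st1 isT isT
  stu sN sV (And3 sW sX sZ) ht outt.
have [||||s' [st' [r3 sO']]] := runs_epilogueA (m := n + c) (w := w0)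
   (setsta (start M) (clr (Regs None b false false (sta s)))) u'_gt0 _ sV2.
- by rewrite st2E.
- by rewrite st2E.
- by rewrite st2E.
- by rewrite st2E.
exists s', st'; split=> //; apply: runs_to.
- apply: runs_seq; first exact: r1.
  by apply: runs_seq; [exact: r2 | exact: r3].
- have le_w0 : size w0 <= 4 * B.
    have := size_enc_dy b (fetch (n + c) v (rev u)) 0.
    by rewrite -w0E size_fetch size_rev /B; lia.
  have le_w1 : size w1 <= 2 * B by rewrite w1E /= size_cat size_nseq /B /=; lia.
  move: le_v; rewrite !size_cat size_nseq size_bits /= add0n.
  set b0 := (size w0 + size w1 + t).+1 => le_v.
  have le_b0 : b0 <= 7 * B by rewrite /b0 /B in le_w0 le_w1 *; lia.
  have le_u' : size u' <= b0 by lia.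
  have le_bb : b0 * b0 <= 49 * (B * B) by apply: leq_trans (leq_mul le_b0 le_b0) _; rewrite mulnACA.
  have le_B : B <= B * B by rewrite leq_pmull // /B; lia.
  have le_n : n + c + size u + 1 <= B by rewrite /B; lia.
  rewrite -!mulnA; move: (b0 * b0) (B * B) le_bb le_B => bb BB; clearbody B b0; lia.
by [].
Qed.

(** * The machine of the rounded integer function *)

Definition skipin (t : tname) : frag := Get t ;; condf (@is_minus Q) (Get t) Skip.

(** Only [cur] changes in the control: [neg] still holds the sign of the dividend, which becomes the
    sign of the quotient. *)
Lemma runs_skipin t h (b : bool) x w s st : st (inl t) = src h (nseq b Minus ++ bit x :: w) ->
  runs (skipin t) (s, st) 3 (setcur (Some (bit x)) s, upd st (inl t) (src (b + h.+1) w)).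
Proof.
case: b => stt; apply: runs_to.
- apply: runs_seq; first exact: runs_get stt.
  by apply: runs_cond => /=; apply: runs_get; exact: upd_same.
- by [].
- by rewrite /= upd_upd.
- apply: runs_seq; first exact: runs_get stt.
  apply: runs_cond; rewrite [is_minus _](_ : _ = false); last by case: (x).
  exact: runs_setr.
- by [].
by [].
Qed.

(** Each digit of [y] also shifts the dividend by one place ([SX]), adds one to the precision to be
    requested ([SN]) and to the number of fractional digits of the quotient ([SD]), and lengthens
    the zero remainder ([SR]), which has to be as long as the divisor. *)
Definition ydigit : frag := Push SX (fun=> Zero) ;; Push SY (@curv Q) ;;
  Push SN (fun=> One) ;; Push SD (fun=> One) ;; Push SR (fun=> Zero).

Definition yread (x : seq bool) st (c : seq bool) : store :=
  st <| SX := bits (nseq (size c) false ++ x) |> <| SY := bits c |>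
     <| SN := nseq (size c) One |> <| SD := nseq (size c) One |>
     <| SR := bits (nseq (size c) false) |>.

Lemma runs_ydigit x st (b : bool) c s z : cur s = Some (bit b) ->
  runs ydigit (s, upd (yread x st c) (inl TIn) z) 10
    (s, upd (yread x st (b :: c)) (inl TIn) z).
Proof.
move=> se; apply: runs_to.
- apply: runs_seq; first by apply: runs_push; exact: erefl.
  apply: runs_seq; first by apply: runs_push; exact: erefl.
  apply: runs_seq; first by apply: runs_push; exact: erefl.
  apply: runs_seq; first by apply: runs_push; exact: erefl.
  by apply: runs_push; exact: erefl.
- by [].
by rewrite /curv se /=; congr pair; apply/funext => -[[]|t].
Qed.

Definition padded st (x : seq bool) m n j : store :=
  st <| SX := bits (nseq (m + j) false ++ x) |> <| SD := nseq (n + j) One |>.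

Definition pad : frag := Push SX (fun=> Zero) ;; Push SD (fun=> One).

Lemma runs_pad st x m n s j : runs pad (s, padded st x m n j) 4 (s, padded st x m n j.+1).
Proof.
apply: runs_to.
- apply: runs_seq; first by apply: runs_push; exact: erefl.
  by apply: runs_push; exact: erefl.
- by [].
by congr pair; apply/funext => -[[]|t] //; rewrite /padded !addnS.
Qed.

(* Puts the quotient, as an oracle word, on [SW], and [size y] in unary on [SN]. *)
Definition prologueB (c : nat) : frag :=
  signin TIn ;; digitsin TIn (Push SX (@curv Q)) ;; skipin TIn ;; digitsin TIn ydigit ;;
  repf c pad ;; Pour SX SZ ;; divide ;; normalize SD.

Lemma runs_prologueB c (bx by_ : bool) xs ys s : 0 < size xs -> 0 < size ys ->
  let m := size ys + c in
  let L := size xs + m + 1 in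
  exists q r y e st, [/\ runs (prologueB c)
      (s, initial (nseq bx Minus ++ bits xs ++ Comma :: nseq by_ Minus ++ bits ys))
      (200 * L * L) (Regs None bx false false (sta s), st),
    [/\ size q = size xs + m, size y <= size r <= 2 * L, bval y = bval (rev ys) &
      0 < bval (rev ys) -> bval (rev xs) * 2 ^ m = bval q * bval (rev ys) + e /\ e < bval (rev ys)],
    [/\ st (inl SW) = stk (enc_dyadic (dy bx (bval q) m)), st (inl SR) = stk (bits r),
      st (inl SY) = stk (bits y) & st (inl SN) = stk (nseq (size ys) One)],
    [/\ st (inl SV) = stk [::], st (inl SZ) = stk [::], st (inl SQ) = stk [::],
      st (inl SC) = stk [::] & st (inl TOut) = dst [::]] &
    scratch st /\ forall t, st (inr t) = blank aux].
Proof.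
case: xs => // x0 xs _; case: ys => // y0 ys _ m L.
have kcE : SD = SC \/ SD = SD by right.
set w := nseq by_ Minus ++ _.
pose st0 : store := initial (nseq bx Minus ++ bits (x0 :: xs) ++ Comma :: w).
pose P q := st0 <| SX := bits q |>.
have rA := @runs_signin TIn 0 bx x0 (bits xs ++ Comma :: w) s st0 erefl.
rewrite [upd _ _ _](_ : _ = upd (P [::]) (inl TIn : T)
   (src (bx + 1) (bits xs ++ Comma :: w))) in rA; last first.
  by apply/funext => -[[]|t] //; exact: blank_stk.
have runF e q s' x : cur s' = Some (bit e) -> runs (Push SX (@curv Q))
    (s', upd (P q) (inl TIn : T) x) 2 (s', upd (P (e :: q)) (inl TIn : T) x).
  move=> se; apply: runs_to; [by apply: runs_push; exact: erefl | by [] |].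
  by rewrite /curv se /=; congr pair; apply/funext => -[[]|t].
have rD := runs_digitsin runF (w := Comma :: w) erefl (x0 :: xs) [::] (bx + 1) bx (fl1 s) (fl2 s) (sta s).
set X := catrev (x0 :: xs) [::] in rD; set Y := catrev (y0 :: ys) [::].
set h := bx + 1 + size (x0 :: xs) in rD.
have XE : X = rev (x0 :: xs) by rewrite /X catrevE cats0.
have YE : Y = rev (y0 :: ys) by rewrite /Y catrevE cats0.
have sY : size Y = size (y0 :: ys) by rewrite YE size_rev.
pose s2 : S := Regs (Some Comma) bx (fl1 s) (fl2 s) (sta s).
have rS := @runs_skipin TIn h by_ y0 (bits ys) s2 (upd (P X) (inl TIn : T) (src h w)) erefl.
rewrite upd_upd [upd _ _ (src (by_ + _) _)](_ : _ = upd (yread X st0 [::]) (inl TIn : T)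
  (src (by_ + h.+1) (bits ys))) in rS; last first.
  by apply/funext => -[[]|t] //; exact: blank_stk.
have rY := runs_digitsin (@runs_ydigit X st0) (w := [::]) erefl (y0 :: ys) [::] (by_ + h.+1)
  bx (fl1 s) (fl2 s) (sta s).
rewrite cats0 -/Y in rY.
set st3 := upd (yread X st0 Y) _ _ in rY.
have rP := runs_repf (n := 4) (F := pad) (P := padded st3 X (size Y) (size Y)) c 0
  (runs_pad st3 X (size Y) (size Y) (Regs None bx (fl1 s) (fl2 s) (sta s))).
rewrite [padded _ _ _ _ 0](_ : _ = st3) in rP; last first.
  by rewrite /padded !addn0; apply/funext => -[[]|t].
rewrite add0n in rP; set st4 := padded _ _ _ _ _ in rP.
pose zs := rev (nseq (size Y + c) false ++ X).
have szs : size zs = size (x0 :: xs) + m.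
  by rewrite /zs size_rev size_cat size_nseq XE size_rev sY /m; lia.
pose st5 := st4 <| SX := [::] |> <| SZ := bits zs |>.
have blank4 t : t \in [:: SZ; SQ; SV; SC; SW; ST; SU; SP] -> st4 (inl t) = stk [::].
  by rewrite -blank_stk; case: t.
have rZ : runs (Pour SX SZ) (Regs None bx (fl1 s) (fl2 s) (sta s), st4) (4 * size zs + 2)
   (Regs None bx (fl1 s) (fl2 s) (sta s), st5).
  apply: runs_to.
  - by apply: runs_pour; [| exact: erefl | exact: blank4].
  - by rewrite size_bits /zs size_rev; lia.
  by rewrite (catrev_bits _ [::]) catrevE cats0.
have scr : scratch st5 by split; exact: blank4.
have [] := @runs_divide zs (nseq (size Y) false) Y [::]
  (Regs None bx (fl1 s) (fl2 s) (sta s)) st5 _ erefl erefl erefl (blank4 SQ isT) scr.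
  by rewrite size_nseq.
move=> r [y [qs [[sr sy sqs vy] vE rV]]].
(* The initial remainder is 0, so the condition of the division becomes positivity of the
   divisor. *)
rewrite size_nseq bval_zeros mul0n add0n in sr sy vE rV.
have szD : size (nseq (size Y + c) One) = m by rewrite size_nseq sY.
have qE : catrev qs [::] = rev qs by rewrite catrevE cats0.
have zsE : bval (rev zs) = bval (rev (x0 :: xs)) * 2 ^ m.
  by rewrite /zs revK bval_cat bval_zeros add0n size_nseq sY XE.
exists (rev qs), r, y, (bval r); eexists; split.
- apply: runs_to.
  + apply: runs_seq; first exact: rA.
    apply: runs_seq; first exact: rD.
    apply: runs_seq; first exact: rS.
    apply: runs_seq; first exact: rY.
    apply: runs_seq; first exact: rP.
    apply: runs_seq; first exact: rZ.
    apply: runs_seq; first exact: rV.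
    by apply: (runs_normalize kcE); [exact: erefl | exact: erefl | exact: (blank4 SW isT)].
  + rewrite szD qE size_rev sqs szs sY.
    have le_k : size (y0 :: ys) + c <= L by rewrite /L /m; lia.
    have le_N : size (x0 :: xs) + m <= L by rewrite /L; lia.
    have le_m : m <= L by rewrite /L; lia.
    have L_gt0 : 0 < L by rewrite /L addn1.
    have le_T : 22 * (size (y0 :: ys) + (size (x0 :: xs) + m)) + 42 <= 44 * L + 42 by lia.
    have := leq_mul le_N le_T; have := leq_mul L_gt0 (leqnn L).
    by move: le_k le_N le_m L_gt0; clear; clearbody m L; rewrite -!mulnA; lia.
  by [].
- split.
  + by rewrite size_rev sqs.
  + by rewrite sr szs sY /L /m in sy *; lia.
  + by rewrite vy YE.
  by rewrite -YE => y_gt0; have := vE y_gt0; rewrite zsE.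
- split; try exact: erefl.
  + by rewrite szD qE.
  by rewrite -sY.
- by split; [exact: (blank4 SV isT) | exact: erefl | exact: erefl | exact: (blank4 SC isT) |
    exact: blank_dst].
split; last by [].
by split; [exact: (blank4 ST isT) | exact: (blank4 SU isT) | exact: (blank4 SP isT)].
Qed.

(** The remainder is overwritten by zeros instead of being emptied: as an accumulator it has to be
    at least as long as [SY]. *)
Definition clearR : frag := ForPop SR (Push SP (fun=> Zero)) ;; Pour SP SR.

Lemma runs_clearR r s st : st (inl SR) = stk (bits r) -> st (inl SP) = stk [::] ->
  runs clearR (s, st) (8 * size r + 4) (setcur None s, st <| SR := bits (nseq (size r) false) |>).
Proof.
move=> sR sP.
have rL : forall (l p : seq bool) s st, st (inl SR) = stk (bits l) -> st (inl SP) = stk (bits p) ->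
    runs (ForPop SR (Push SP (fun=> Zero))) (s, st) (4 * size l + 2)
      (setcur None s, st <| SR := [::] |> <| SP := bits (ncons (size l) false p) |>).
  elim=> [|b l IH] p s' st' sR' sP'.
    by apply: runs_to; [exact: runs_forpop_nil sR' | by [] | rewrite /= !upd_id].
  apply: runs_to; first apply: runs_forpop_cons sR' _ (IH (false :: p) _ _ _ _).
  - by apply: runs_push; exact: sP'.
  - exact: erefl.
  - exact: erefl.
  - by rewrite /=; lia.
  congr pair; apply/funext => -[[]|t] //=.
  by congr stk; elim: (size l) => //= n [->].
apply: runs_to.
- apply: runs_seq; first by apply: (rL r [::]); [exact: sR | exact: sP].
  by apply: runs_pour; [| exact: erefl | exact: erefl].
- by rewrite size_bits size_ncons /= addn0; lia.
congr pair; apply/funext => -[[]|t] //=.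
by congr stk; rewrite (catrev_bits _ [::]) catrevE cats0 -[ncons _ _ _]/(nseq _ _) rev_nseq.
Qed.

Definition dropfrac : frag := ForPop SC (Pop SR).

Lemma runs_dropfrac c r s st : st (inl SC) = stk c -> st (inl SR) = stk (bits r) ->
  runs dropfrac (s, st) (3 * size c + 2)
    (setcur None s, st <| SC := [::] |> <| SR := bits (drop (size c) r) |>).
Proof.
elim: c r s st => [|a c IH] r s st sC sR.
  by apply: runs_to; [exact: runs_forpop_nil sC | by [] | rewrite /= drop0 !upd_id].
apply: runs_to; first apply: runs_forpop_cons sC _ (IH (behead r) _ _ _ _).
- by apply: runs_pop; exact: sR.
- exact: erefl.
- by rewrite /bits -behead_map; exact: erefl.
- by rewrite /=; lia.
congr pair; apply/funext => -[[]|t] //=.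
by case: r {sR}.
Qed.

Definition not_point (a : sym) : bool := if a is Point then false else true.

(** The dyadic numeral of an integer is its integer numeral followed by the point, so [normalize]
    serves for integers as well once the point is filtered out. *)
Lemma filter_not_point (b : bool) V :
  filter not_point (enc_dyadic (dy b V 0)) = enc_int (((-1) ^+ b * V%:Z)%R).
Proof.
rewrite enc_dy // expn0 divn1 /enc_int.
have -> : ((-1) ^+ b * V%:Z < 0)%R = b && (V != 0).
  case: b; rewrite ?expr1 ?expr0 ?mulN1r ?mul1r /=; last by rewrite ltNge.
  by rewrite oppr_lt0; case: V.
have -> : `|((-1) ^+ b * V%:Z)%R|%N = V by case: b; rewrite ?expr1 ?expr0 ?mulN1r ?mul1r ?abszN.
have [l -> _] := bits_bin V.
rewrite !filter_cat /= cats0; congr cat.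
  by case: (b && _).
by elim: (rev l) => //= -[] l' ->.
Qed.

Definition epilogueB : frag :=
  Drain SW ;; clearR ;; signf ;; horner_int ;; horner_frac ;; dropfrac ;;
  Pour SR SZ ;; Pour SZ SQ ;; normalize SC ;; emit (fun s => not_point (curv s)).

Lemma runs_epilogueB (b : bool) u v w r y s st : 0 < size u -> size y <= size r ->
  st (inl SW) = stk w -> st (inl SV) = stk (nseq b Minus ++ bits u ++ Point :: bits v) ->
  st (inl SR) = stk (bits r) -> st (inl SY) = stk (bits y) -> scratch st ->
  st (inl SC) = stk [::] -> st (inl SZ) = stk [::] -> st (inl SQ) = stk [::] ->
  st (inl TOut) = dst [::] ->
  let L := size w + size r + size u + size v + 1 in
  exists s' st', runs epilogueB (s, st) (300 * L * L) (s', st') /\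
    st' (inl TOut) = dst (enc_int ((-1) ^+ b * ((bval (rev (u ++ v)) * bval y) %/ 2 ^ size v)%:Z)%R).
Proof.
case: u => // u0 u _ le_y sW sV sR sY [sT sU sP] sC sZ sQ sO L.
have kcE : SC = SC \/ SC = SD by left.
pose st1 := st <| SW := [::] |> <| SR := bits (nseq (size r) false) |>
  <| SV := bits (u0 :: u) ++ Point :: bits v |>.
have scr1 : scratch st1 by [].
have le_y1 : size y <= size (nseq (size r) false) by rewrite size_nseq.
have [r2 [y2 [sr2 vy2 vr2 r_int]]] := @runs_horner_int (u0 :: u) (bits v)
  (nseq (size r) false) y (Regs None b false false (sta s)) st1 le_y1 erefl erefl sY scr1.
rewrite size_nseq bval_zeros mul0n add0n in sr2 vr2 r_int.
set st2 := upd _ _ _ in r_int.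
have scr2 : scratch st2 by [].
have le_y2 : size y2 <= size r2 by lia.
have [r3 [y3 [sr3 vy3 vr3 r_frac]]] := @runs_horner_frac v r2 y2
  (Regs None b false false (sta s)) st2 [::] le_y2 erefl sC erefl erefl scr2.
set st3 := upd _ _ _ in r_frac.
have r_drop := @runs_dropfrac (ncons (size v) One [::]) r3
  (Regs None b false false (sta s)) st3 erefl erefl.
rewrite size_ncons addn0 in r_drop.
eexists _, _; split.
  apply: runs_to.
  - apply: runs_seq; first by apply: runs_drain; exact: sW.
    apply: runs_seq; first by apply: (@runs_clearR r); [exact: sR | exact: sP].
    apply: runs_seq.
      by apply: (runs_signf (x := u0) (w := bits u ++ Point :: bits v)); exact: sV.
    apply: runs_seq; first exact: r_int.
    apply: runs_seq; first exact: r_frac.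
    apply: runs_seq; first exact: r_drop.
    apply: runs_seq; first by apply: runs_pour; [| exact: erefl | exact: sZ].
    apply: runs_seq; first by apply: runs_pour; [| exact: erefl | exact: sQ].
    apply: runs_seq.
      apply: (runs_normalize kcE); [exact: erefl | | exact: erefl].
      by rewrite upd_same !(catrev_bits _ [::]); exact: erefl.
    by apply: (@runs_emit not_point _ [::]); [exact: erefl | exact: sO].
  - rewrite !(catrev_bits _ [::]) !size_bits !catrevE !cats0 revK size_rev size_drop.
    set e := enc_dyadic _.
    have := size_enc_dy b (drop (size v) r3) 0; rewrite -/e size_drop addn0 => le_e.
    have le_u : size (u0 :: u) <= L by rewrite /L; lia.
    have le_v : size v <= L by rewrite /L; lia.
    have le_T1 : 22 * (size r + 2 * size (u0 :: u)) + 44 <= 44 * L + 44 by rewrite /L; lia.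
    have le_T2 : 22 * (size r2 + 2 * size v) + 46 <= 44 * L + 46 by rewrite /L; lia.
    have L_gt0 : 0 < L by rewrite /L addn1.
    have le_D : size r3 - size v <= 2 * L by rewrite /L; lia.
    have le_wr : size w + size r <= L by rewrite /L; lia.
    have := leq_mul le_u le_T1; have := leq_mul le_v le_T2; have := leq_mul L_gt0 (leqnn L).
    move: le_u le_v le_T1 le_T2 L_gt0 le_D le_wr le_e; clear; clearbody L e.
    have -> : size ([::] : seq sym) = 0 by []; lia.
  by [].
rewrite upd_same /= filter_not_point !catrevE !cats0 revK bval_drop vr3 vr2 vy2.
by rewrite -cat_cons rev_cat bval_cat size_rev mulnDl mulnAC addnC.
Qed.

(** All oracles are to answer the same word, so [SW] serves as both oracle stacks. *)
Definition programB (c : nat) : frag :=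
  prologueB c ;; Simulate SW SW SN SV ;; epilogueB.

(** The quotient [q] comes before [psi] in the quantifiers, since the oracle to be simulated answers
    the very number that the division has produced. *)
Lemma runs_programB c (bx by_ : bool) xs ys s : 0 < size xs -> 0 < size ys ->
  let m := size ys + c in
  let Y := bval (rev ys) in
  exists q e, [/\ size q = size xs + m,
    0 < Y -> bval (rev xs) * 2 ^ m = bval q * Y + e /\ e < Y &
    forall (psi : 'I_d' -> nat -> rat) (t : nat) (b : bool) u v,
    (forall i j, psi i j = dy bx (bval q) m) ->
    halted (run M psi (nseq (size ys) One) t) ->
    outputs (run M psi (nseq (size ys) One) t) (nseq b Minus ++ bits u ++ Point :: bits v) ->
    0 < size u ->
    let B := size xs + m + t + 1 in
    exists s' st', runs (programB c)
        (s, initial (nseq bx Minus ++ bits xs ++ Comma :: nseq by_ Minus ++ bits ys))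
        (150 * 1000 * B * B) (s', st') /\
      st' (inl TOut) = dst (enc_int ((-1) ^+ b * ((bval (rev (u ++ v)) * Y) %/ 2 ^ size v)%:Z)%R)].
Proof.
move=> xs_gt0 ys_gt0 m Y.
have [q [r [y [e [st1 [r1 [sq sry vy qE] [sW sR sY sN] [sV sZ sQ sC sO] [scr stu]]]]]]] :=
  @runs_prologueB c bx by_ xs ys s xs_gt0 ys_gt0.
exists q, e; split=> // psi t b u v psiE ht outt u_gt0 B.
set w0 := enc_dyadic _ in sW.
have psiE' i j : enc_dyadic (psi i j) = if i == 0 :> nat then w0 else w0.
  by rewrite psiE if_same.
have le_w0 : size w0 <= 5 * B.
  by have := size_enc_dy bx q m; rewrite -/m -/w0 sq /B; lia.
clearbody w0.
have [le_v [st2 [r2 sV2 st2E]]] := @runs_simulate d d' tname M (inl TQ) (inl TAns) phi SZ SW SW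
  isT isT psi w0 w0 psiE' SN SV (nseq (size ys) One) t _ (Regs None bx false false (sta s)) st1
  isT isT stu sN sV (And3 sW sW sZ) ht outt.
have [sT sU sP] := scr.
have scr2 : scratch st2 by split; rewrite st2E.
have le_yr : size y <= size r by case/andP: sry.
have [|||||||s' [st' [r3 sO']]] := @runs_epilogueB b u v w0 r y
   (setsta (start M) (clr (Regs None bx false false (sta s)))) st2 u_gt0 le_yr _ sV2 _ _ scr2.
- by rewrite st2E.
- by rewrite st2E.
- by rewrite st2E.
- by rewrite st2E.
- by rewrite st2E.
- by rewrite st2E.
- by rewrite st2E.
exists s', st'; split; last by rewrite sO' vy.
apply: runs_to.
- apply: runs_seq; first exact: r1.
  by apply: runs_seq; [exact: r2 | exact: r3].
- move: le_v; rewrite !size_cat !size_nseq !size_bits /= size_bits.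
  set b0 := (size ys + size w0 + size w0 + t).+1 => le_v.
  have le_b0 : b0 <= 12 * B by rewrite /b0 /B /m in le_w0 *; lia.
  set L := size xs + m + 1 in sry *.
  have le_L : L <= B by rewrite /L /B; lia.
  set L' := size w0 + size r + size u + size v + 1.
  have le_L' : L' <= 20 * B.
    have : 1 <= B by rewrite /B; lia.
    by rewrite /L'; lia.
  have e1 : L * L <= B * B by exact: leq_mul.
  have e2 : b0 * b0 <= 144 * (B * B).
    by apply: leq_trans (leq_mul le_b0 le_b0) _; rewrite mulnACA.
  have e3 : L' * L' <= 400 * (B * B).
    by apply: leq_trans (leq_mul le_L' le_L') _; rewrite mulnACA.
  rewrite -!mulnA; move: (L * L) (b0 * b0) (L' * L') (B * B) e1 e2 e3; clear; lia.
by [].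
Qed.

End Programs.

(** * Polynomial bounds and error estimates *)

Section PolynomialBounds.
Local Open Scope ring_scope.

(** A form of polynomial bound in which closure under sums, products and powers is plain
    monotonicity; [n.+1] in place of [n] makes powers increase with the exponent also at 0. *)
Definition pbound (F : nat -> nat) := exists c k, forall n, (F n <= c * n.+1 ^ k)%N.

Lemma pbound_const c : pbound (fun=> c).
Proof. by exists c, 0%N => n; rewrite expn0 muln1. Qed.

Lemma pbound_id : pbound id.
Proof. by exists 1%N, 1%N => n; rewrite mul1n expn1. Qed.

Lemma pboundD F G : pbound F -> pbound G -> pbound (fun n => F n + G n)%N.
Proof.
move=> [c [k Fc]] [c' [k' Gc]]; exists (c + c')%N, (k + k')%N => n.
rewrite mulnDl; apply: leq_add; [apply: leq_trans (Fc n) _ | apply: leq_trans (Gc n) _].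
  by rewrite leq_mul2l leq_pexp2l ?leq_addr ?orbT.
by rewrite leq_mul2l leq_pexp2l ?leq_addl ?orbT.
Qed.

Lemma pboundM F G : pbound F -> pbound G -> pbound (fun n => F n * G n)%N.
Proof.
move=> [c [k Fc]] [c' [k' Gc]]; exists (c * c')%N, (k + k')%N => n.
by rewrite expnD mulnACA leq_mul.
Qed.

Lemma pboundX F k : pbound F -> pbound (fun n => F n ^ k)%N.
Proof.
move=> Fb; elim: k => [|k IH]; first exact: pbound_const.
have [c [j H]] := pboundM Fb IH.
by exists c, j => n; rewrite expnS H.
Qed.

Lemma poly_pbound (q : {poly nat}) : pbound (fun n => q.[n]).
Proof.
elim/poly_ind: q => [|q a IH]; first by exists 0%N, 0%N => n; rewrite horner0.
have [c [k H]] := pboundD (pboundM IH pbound_id) (pbound_const a).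
by exists c, k => n; rewrite hornerMXaddC; exact: H.
Qed.

Lemma poly2_pbound (p : {poly {poly nat}}) :
  exists c k, forall a b N, (a + b <= N)%N -> (p.[a, b] <= c * N.+1 ^ k)%N.
Proof.
elim/poly_ind: p => [|p q [c [k IH]]].
  by exists 0%N, 0%N => a b N _; rewrite horner0 horner0.
have [c' [k' Hq]] := poly_pbound q.
exists (c + c')%N, (k + k').+1 => a b N le_N.
rewrite hornerMXaddC hornerD hornerM hornerC.
have IHN := IH a b N le_N.
have Hb := Hq b.
rewrite mulnDl; apply: leq_add.
  apply: (@leq_trans (c * N.+1 ^ k * N.+1)); first by apply: leq_mul; rewrite // leqW //; lia.
  by rewrite -mulnA -expnSr leq_mul2l leq_pexp2l ?orbT // ltnS leq_addr.
apply: leq_trans Hb _; rewrite leq_mul //; apply: (@leq_trans (N.+1 ^ k')).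
  by case: (k') => // j; rewrite leq_exp2r // ltnS; lia.
by rewrite leq_pexp2l // leqW // leq_addl.
Qed.

Lemma pbound_poly2 F : pbound F ->
  exists p : {poly {poly nat}}, forall a b, (F (a + b) <= p.[a, b])%N.
Proof.
move=> [c [k Fc]]; exists (c%:P%:P * ('X + 'X%:P + 1) ^+ k) => a b.
rewrite hornerM horner_exp !hornerE natrXE !natrDE natrME.
by rewrite addn1.
Qed.
End PolynomialBounds.

(** The shape of every oracle word and every answer. The length of [u] bounds the time to read it,
    and the value of [u] is what remains when the fraction is dropped. *)
Lemma decode q : dyadic q -> exists (b : bool) u v,
  [/\ enc_dyadic q = nseq b Minus ++ bits u ++ Point :: bits v, 0 < size u,
      q = dy b (bval (rev (u ++ v))) (size v) &
      size u = (trunc_log 2 (bval (rev (u ++ v)) %/ 2 ^ size v)).+1 /\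
      bval (rev u) = bval (rev (u ++ v)) %/ 2 ^ size v].
Proof.
move=> /dyadic_dy[s [V [j [jV ->]]]].
have [l El [vl sl]] := bits_bin (V %/ 2 ^ j).
have [l2 El2 [sl2 vl2]] := bits_digits V j.
(* The numeral of 0 carries no sign, so the sign is corrected; the value does not change. *)
exists (s && (V != 0)), (rev l), (rev l2).
have VE : bval (rev (rev l ++ rev l2)) = V.
  by rewrite rev_cat !revK bval_cat vl vl2 sl2 addnC -divn_eq.
rewrite VE !size_rev sl2 revK vl; split.
- by rewrite enc_dy // El El2.
- by rewrite sl.
- rewrite /dy; case: eqP => [->|_]; last by rewrite andbT.
  by rewrite andbF !mulr0 !mul0r.
by rewrite sl.
Qed.

Lemma dyadic_of_dy s V m : dyadic (dy s V m).
Proof.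
exists ((-1) ^+ s * V%:Z)%R, m.
by rewrite /dy rmorphM /= rmorphXn /= rmorphN1.
Qed.

(** * Real values and magnitudes of dyadic numbers *)

Section Reals.
Variable R : realType.
Local Open Scope ring_scope.

Lemma lipschitzE (K : R) (f : R -> R) : K.-lipschitz f ->
  forall x y, `|f x - f y| <= K * `|x - y|.
Proof. by move=> fL x y; have := fL (x, y); apply. Qed.

Lemma ratr_dy s V m : ratr (dy s V m) = (-1) ^+ s * V%:R / 2 ^+ m :> R.
Proof.
rewrite /dy !rmorphM /= rmorph_sign ratr_nat fmorphV rmorphXn /=.
by rewrite (ratr_nat _ 2).
Qed.

Lemma magnitude_le d (x : 'I_d -> R) j :
  (forall i, `|x i| <= 2 ^+ j) -> (magnitude x <= j)%N.
Proof.
move=> xj; rewrite /magnitude; case: ex_minnP => m _ mP; apply: mP.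
by apply/forallP => i; rewrite -ler_norml.
Qed.

Lemma le_magnitude d (x : 'I_d -> R) i : `|x i| <= 2 ^+ magnitude x.
Proof.
rewrite /magnitude; case: ex_minnP => m /forallP mP _.
by rewrite ler_norml.
Qed.

Lemma CF_const q : dyadic q -> CF (ratr q : R) (fun=> q).
Proof. by move=> dq n; split=> //; rewrite subrr normr0 invr_ge0 exprn_ge0. Qed.

Lemma exp2_archi (x : R) : exists c, x <= 2 ^+ c.
Proof.
exists (Num.bound `|x|); apply: le_trans (ler_norm x) _.
apply/ltW/(lt_le_trans (archi_boundP (normr_ge0 x))).
by rewrite -natrX ler_nat ltnW // ltn_expl.
Qed.

End Reals.

Section Main.
Variable R : realType.
Local Open Scope ring_scope.

Lemma uniq_tapes (U : finType) :
  uniq [:: inl TIn; inl TOut; inl TQ; inl TAns : tname + U].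
Proof. by []. Qed.

Definition reg0 d' (M : otm d') : regs (state M) := Regs None false false false (start M).

Definition machineA (M : otm 2) (c : nat) : otm 1 :=
  machine (uniq_tapes _) (programA M ord0 c) (reg0 M).
Definition machineB (M : otm 1) (c : nat) : otm 0 :=
  machine (uniq_tapes _) (programB 0 M c) (reg0 M).

Lemma initialE d' (M : otm d') w : (fun t : tname + tape M =>
  if t == inl TIn then (wordf (bool * cell (aux M))%type w, 0%N) else blank _) = initial w.
Proof. by apply/funext => t; rewrite /initial src0. Qed.

(** Correctness and running time are separate clauses of the definitions. This carries the output
    found at some unspecified halting time [t] over to the polynomial time [t']. *)
Lemma outputs_halted d (M : otm d) phi w t t' v :
  halted (run M phi w t) -> outputs (run M phi w t) v -> halted (run M phi w t') ->
  outputs (run M phi w t') v.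
Proof.
move=> ht ot ht'; have [le_t|/ltnW le_t] := leqP t t'.
  by rewrite /run (@iter_halted _ _ _ _ t).
by move: ot; rewrite /run (@iter_halted _ _ _ _ t').
Qed.

Lemma sign_dist (b : bool) (x y : R) : `|(-1) ^+ b * x - (-1) ^+ b * y| = `|x - y|.
Proof. by rewrite -mulrBr normrM normrX normrN1 expr1n mul1r. Qed.

Lemma normr_dy s V m : `|ratr (dy s V m)| = V%:R / 2 ^+ m :> R.
Proof.
rewrite ratr_dy -mulrA normrM normrX normrN1 expr1n mul1r ger0_norm //.
by rewrite divr_ge0 // exprn_ge0.
Qed.

Lemma divn_le W k : (W %/ 2 ^ k)%:R <= W%:R / 2 ^+ k :> R.
Proof. by rewrite ler_pdivlMr ?exprn_gt0 // -natrX -natrM ler_nat leq_divM. Qed.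

Lemma divn_dist W k : `|(W %/ 2 ^ k)%:R - W%:R / 2 ^+ k| <= 1 :> R.
Proof.
have k_gt0 : 0 < 2 ^+ k :> R by rewrite exprn_gt0.
have /(congr1 (fun n => n%:R : R)) := divn_eq W (2 ^ k).
have : ((W %% 2 ^ k)%:R : R) <= 2 ^+ k.
  by rewrite -natrX ler_nat ltnW // ltn_pmod // expn_gt0.
have : 0 <= ((W %% 2 ^ k)%:R : R) by [].
rewrite natrD natrM natrX; move: (W %% _)%:R (W %/ _)%:R => r v r_ge0 r_le ->.
rewrite mulrDl mulfK ?gt_eqF // opprD addNKr normrN ger0_norm ?divr_ge0 ?(ltW k_gt0) //.
by rewrite ler_pdivrMr // mul1r.
Qed.

Lemma fetch_dist m v u :
  `|(bval (fetch m v (rev u)))%:R - (bval (rev (u ++ v)))%:R / 2 ^+ size v * 2 ^+ m| <= 1 :> R.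
Proof.
set W := bval (rev (u ++ v)); have k_gt0 : 0 < 2 ^+ size v :> R by rewrite exprn_gt0.
have /andP[] := fetch_bval m v u; rewrite -/W.
set X := bval _; rewrite -(ler_nat R) -(ltr_nat R) !natrM -natr1 !natrX.
rewrite mulrAC; move: X%:R (W%:R * _) => x w le1 le2.
have := le1; rewrite -ler_pdivlMr // => le1'.
have := ltW le2; rewrite -ler_pdivrMr // => le2'.
by rewrite ler_norml; apply/andP; split; lra.
Qed.

(** * From definability to polynomial time *)

Section FromDefinable.
Variables (f : R -> R) (K : R) (g : R -> R -> R).
Hypotheses (K_ge0 : 0 <= K) (lipf : forall x y, `|f x - f y| <= K * `|x - y|).
Hypothesis gf : forall x y : int, 1 <= y ->
  `|g x%:~R y%:~R - y%:~R * f (x%:~R / y%:~R)| <= 3.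

(** The budget [5 + 2 * K] at scale [2 ^ m]: 1 for the dropped fraction ([rV]), 1 for the simulated
    machine ([rg]), 3 for definability ([Gf]), and [2 * K] for the distance from [xi / 2 ^ m] to [x]
    ([fxi]). *)
Lemma rescaled_value (x : R) n c (b : bool) V k (X : nat) (b0 : bool) W j :
  5 + 2 * K <= 2 ^+ c -> let m := (n + c)%N in
  `|x - (-1) ^+ b0 * W%:R / 2 ^+ j| <= 2 ^- m ->
  `|X%:R - W%:R / 2 ^+ j * 2 ^+ m : R| <= 1 ->
  `|(-1) ^+ b * V%:R / 2 ^+ k - g ((-1) ^+ b0 * X%:R) (2 ^+ m)| <= 1 ->
  `|(-1) ^+ b * (V %/ 2 ^ k)%:R / 2 ^+ m - f x| <= 2 ^- n.
Proof.
move=> cK m xq Xq rg; set P := 2 ^+ m; have P_gt0 : 0 < P by rewrite exprn_gt0.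
have P_neq0 : P != 0 by rewrite gt_eqF.
pose xi : R := (-1) ^+ b0 * X%:R.
have Gf : `|g xi P - P * f (xi / P)| <= 3.
  have := gf ((-1) ^+ b0 * X%:Z) (y := (2 ^ m)%N).
  rewrite rmorphM /= rmorph_sign -!pmulrn natrX; apply.
  by rewrite lez_nat expn_gt0.
(* One [2 ^- m] comes from the oracle answer, the other from cutting it off after [m] fractional
   digits. *)
have xxi : `|xi / P - x| <= 2 * P^-1.
  have e1 : `|xi / P - (-1) ^+ b0 * W%:R / 2 ^+ j| <= P^-1.
    rewrite -!mulrA sign_dist -[X in _ - X](mulfK P_neq0) -mulrBl normrM.
    by rewrite (gtr0_norm (x := P^-1)) ?invr_gt0 // ler_piMl // invr_ge0 ltW.
  move: e1 xq; rewrite -/P !ler_norml => /andP[? ?] /andP[? ?].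
  by apply/andP; split; lra.
have fxi : `|P * f (xi / P) - P * f x| <= 2 * K.
  rewrite -mulrBr normrM (gtr0_norm P_gt0).
  apply: (@le_trans _ _ (P * (K * (2 * P^-1)))).
    by rewrite ler_wpM2l ?(ltW P_gt0) // (le_trans (lipf _ _)) // ler_wpM2l.
  by rewrite [leLHS](_ : _ = 2 * K) //; field.
have rV : `|(-1) ^+ b * (V %/ 2 ^ k)%:R - (-1) ^+ b * V%:R / 2 ^+ k : R| <= 1.
  by rewrite -mulrA sign_dist divn_dist.
set o := (-1) ^+ b * (V %/ 2 ^ k)%:R in rV *.
have oP : `|o - P * f x| <= 2 ^+ c.
  apply: le_trans cK; move: rg; rewrite -/xi -/P => rg.
  move: rV rg Gf fxi; rewrite !ler_norml => /andP[? ?] /andP[? ?] /andP[? ?] /andP[? ?].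
  by apply/andP; split; lra.
have -> : o / P - f x = (o - P * f x) / P by field.
rewrite normrM (gtr0_norm (x := P^-1)) ?invr_gt0 // ler_pdivrMr //.
by apply: le_trans oP _; rewrite /P /m exprD mulKf ?lexx // expf_neq0 // pnatr_eq0.
Qed.

Lemma polytime_of_definable : polytime_real2 g -> polytime_real1 f.
Proof.
move=> [M Mg [p Mp]]; have [c cK] := exp2_archi (5 + 2 * K).
have [c1 [k1 pE]] := poly2_pbound p.
(* With [N = magnitude x + n], the integer part read has at most [magnitude x + 2] digits. Hence
   [N + (c + 2)] bounds the length of the data and the magnitude of the arguments given to [g], and
   the power bounds the simulated running time. *)
pose B N := (N + (c + 2) + c1 * (N + (c + 2) + 1) ^ k1 + 1)%N.
pose F N := (120 * 100 * B N * B N)%N.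
have F_pbound : pbound F.
  have BP : pbound B.
    apply: pboundD; last exact: pbound_const.
    apply: pboundD; first exact: pboundD pbound_id (pbound_const _).
    apply: pboundM; first exact: pbound_const.
    apply: pboundX; apply: pboundD; last exact: pbound_const.
    exact: pboundD pbound_id (pbound_const _).
  by apply: pboundM (BP); apply: pboundM (BP); exact: pbound_const.
(* Stated for every [T] beyond the bound, this gives both correctness and running time. *)
have key (x : 'I_1 -> R) (phi : 'I_1 -> nat -> rat) n T :
    (forall i, CF (x i) (phi i)) -> (F (magnitude x + n) <= T)%N ->
    halted (run (machineA M c) phi (nseq n One) T) /\ exists q : rat,
      [/\ dyadic q, outputs (run (machineA M c) phi (nseq n One) T) (enc_dyadic q) &
      `|ratr q - f (x ord0)| <= 2 ^- n].
  move=> xphi le_T; pose m := (n + c)%N.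
  have [dq xq] := xphi ord0 m.
  have [b0 [u [v [encE u_gt0 qE [su _]]]]] := decode dq.
  set W := bval _ in qE su; set X := bval (fetch m v (rev u)).
  pose w0 := enc_dyadic (dy b0 X 0); pose w1 := enc_dyadic (dy false (2 ^ m) 0).
  pose psi (i : 'I_2) (j : nat) := if i == 0 :> nat then dy b0 X 0 else dy false (2 ^ m) 0.
  pose xx (i : 'I_2) : R := ratr (psi i 0%N).
  have xpsi i : CF (xx i) (psi i).
    by rewrite /xx /psi; case: ifP => _; apply: CF_const; exact: dyadic_of_dy.
  have xx0 : xx ord0 = (-1) ^+ b0 * X%:R by rewrite /xx /psi ratr_dy expr0 divr1.
  have xx1 : xx ord_max = 2 ^+ m by rewrite /xx /psi ratr_dy !expr0 divr1 mul1r natrX.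
  have [t [ht [r [dr outr rg]]]] := Mg xx psi xpsi 0%N.
  have hT := Mp xx psi xpsi 0%N; set t' := p.[_, _] in hT.
  have {ht}outr := outputs_halted ht outr hT.
  have [b [u' [v' [encE' u'_gt0 rE [_ vu']]]]] := decode dr.
  rewrite encE' in outr.
  have psiE i j : enc_dyadic (psi i j) = if i == 0 :> nat then w0 else w1.
    by rewrite /psi /w0 /w1; case: ifP.
  have w1E : w1 = One :: nseq m Zero ++ [:: Point].
    rewrite /w1 enc_dy // expn0 divn1.
    have -> : (2 ^ m)%N = bval (rcons (nseq m false) true).
      by rewrite bval_rcons bval_zeros size_nseq mul1n.
    by rewrite bin_bval rev_rcons rev_nseq /= /bits map_nseq.
  have [s' [st' [rA outA]]] := @runs_programA 1 2 M phi ord0 psi c n b0 b u v u' (bits v') t'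
    (reg0 M) w0 w1 encE u_gt0 erefl w1E psiE hT outr u'_gt0.
  have le_B : (n + c + size u + t' + 1 <= B (magnitude x + n))%N.
    (* The oracle answer is within [2 ^- m <= 1] of [x], so its absolute value is at most
       [2 ^ magnitude x + 1]. *)
    have le_W : (W %/ 2 ^ size v <= 2 ^ (magnitude x).+1)%N.
      rewrite -(ler_nat R) natrX exprS; apply: le_trans (divn_le _ _) _.
      have := le_magnitude x ord0; rewrite -(normr_dy b0) -qE.
      have : 1 <= 2 ^+ magnitude x :> R by rewrite exprn_ege1 // ler1n.
      have : 2 ^- m <= 1 :> R by rewrite invf_le1 ?exprn_gt0 // exprn_ege1 // ler1n.
      have := ler_distD (x ord0) 0 (ratr (phi ord0 m)).
      by move: xq; rewrite !sub0r !normrN; lra.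
    have le_u : (size u <= (magnitude x).+2)%N.
      rewrite su ltnS -[leqRHS](trunc_expnK (p := 2)) //.
      exact: leq_trunc_log.
    have le_xx : (magnitude xx <= m + size u)%N.
      apply: magnitude_le => i.
      rewrite /xx /psi; case: ifP => _; rewrite normr_dy expr0 divr1 -natrX ler_nat.
        by apply/ltnW/(leq_trans (bval_lt _)); rewrite size_fetch size_rev.
      by rewrite leq_pexp2l // leq_addr.
    have : (t' <= c1 * (magnitude x + n + (c + 2) + 1) ^ k1)%N.
      by rewrite addn1; apply: pE; rewrite addn0 /m in le_xx *; lia.
    by rewrite /B; lia.
  rewrite -initialE in rA.
  have stO : (st' (inl TOut)).1 = wordf _ (enc_dyadic (dy b (bval (rev u')) m)) by rewrite outA.
  have [|hA oA] := run_machine (uniq_tapes _) rA stO (m := T).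
    apply: leq_trans le_T; rewrite /F -!mulnA !leq_mul2l; apply/orP; right.
    by apply/orP; right; exact: leq_mul.
  split=> //; exists (dy b (bval (rev u')) m); split=> //.
    exact: dyadic_of_dy.
  rewrite ratr_dy vu'; apply: (rescaled_value (X := X) (b0 := b0) (W := W) (j := size v) cK).
  - by rewrite -[(-1) ^+ _ * _ / _]ratr_dy -qE.
  - exact: fetch_dist.
  by rewrite -ratr_dy -rE -xx0 -xx1; move: rg; rewrite expr0 invr1.
exists (machineA M c).
  move=> x phi xphi n; exists (F (magnitude x + n)).
  by apply: key.
have [q qF] := pbound_poly2 F_pbound; exists q => x phi xphi n.
by have [] := key x phi n q.[magnitude x, n] xphi (qF _ _).
Qed.

End FromDefinable.

(** * From polynomial time to an integer approximation *)

Section FromPolytime.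
Variables (f : R -> R) (K : R).
Hypotheses (K_ge0 : 0 <= K) (lipf : forall x y, `|f x - f y| <= K * `|x - y|).

(** Multiplication by [Y <= 2 ^ k] turns the precision [2 ^- k] of the machine into an error of at
    most 1, and the distance [2 ^- (k + c)] from [q0] to [x0] into at most [K / 2 ^ c <= 1 / 2];
    rounding the product to an integer costs 1. *)
Lemma rounded_product (bx b : bool) (X Y q e k c W j : nat) :
  2 * K <= 2 ^+ c -> (0 < Y)%N -> (Y <= 2 ^ k)%N ->
  (X * 2 ^ (k + c) = q * Y + e)%N -> (e < Y)%N ->
  `|(-1) ^+ b * W%:R / 2 ^+ j - f ((-1) ^+ bx * q%:R / 2 ^+ (k + c))| <= 2 ^- k ->
  `|(-1) ^+ b * ((W * Y) %/ 2 ^ j)%:R - Y%:R * f ((-1) ^+ bx * X%:R / Y%:R)| <= 5 / 2.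
Proof.
move=> cK Y_gt0 le_Y XE lt_e rf.
have y_gt0 : 0 < Y%:R :> R by rewrite ltr0n.
have y_neq0 : Y%:R != 0 :> R by rewrite gt_eqF.
have k_gt0 : 0 < 2 ^+ k :> R by rewrite exprn_gt0.
have c_gt0 : 0 < 2 ^+ c :> R by rewrite exprn_gt0.
have le_yk : Y%:R <= 2 ^+ k :> R by rewrite -natrX ler_nat.
set q0 := (-1) ^+ bx * q%:R / _ in rf; set x0 := (-1) ^+ bx * X%:R / _.
have qx : `|q0 - x0| <= (2 ^+ k * 2 ^+ c)^-1.
  rewrite /q0 /x0 -!mulrA sign_dist exprD.
  have /(congr1 (fun n => n%:R : R)) := XE; rewrite natrM natrD natrM natrX exprD => XER.
  have le_e : e%:R <= Y%:R :> R by rewrite ler_nat ltnW.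
  have -> : q%:R / (2 ^+ k * 2 ^+ c) - X%:R / Y%:R =
      - ((e%:R / Y%:R) * (2 ^+ k * 2 ^+ c)^-1) :> R.
    have -> : e%:R = X%:R * (2 ^+ k * 2 ^+ c) - q%:R * Y%:R :> R by rewrite XER addrC addKr.
    by field; rewrite y_neq0 !gt_eqF.
  rewrite normrN normrM ger0_norm ?divr_ge0 // ger0_norm ?invr_ge0 ?mulr_ge0 ?(ltW k_gt0) ?(ltW c_gt0) //.
  by rewrite ler_piMl ?invr_ge0 ?mulr_ge0 ?(ltW k_gt0) ?(ltW c_gt0) // ler_pdivrMr // mul1r.
have fx : `|Y%:R * f q0 - Y%:R * f x0| <= 1 / 2.
  rewrite -mulrBr normrM (gtr0_norm y_gt0).
  apply: (@le_trans _ _ (2 ^+ k * (K * (2 ^+ k * 2 ^+ c)^-1))).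
    apply: ler_pM => //; apply: le_trans (lipf _ _) _.
    by rewrite ler_wpM2l.
  rewrite [leLHS](_ : _ = K / 2 ^+ c); last by field; rewrite !gt_eqF.
  by rewrite ler_pdivrMr //; lra.
have rY : `|Y%:R * ((-1) ^+ b * W%:R / 2 ^+ j) - Y%:R * f q0| <= 1.
  rewrite -mulrBr normrM (gtr0_norm y_gt0); apply: le_trans (ler_wpM2l (ltW y_gt0) rf) _.
  by rewrite ler_pdivrMr // mul1r.
have hr : `|(-1) ^+ b * ((W * Y) %/ 2 ^ j)%:R - Y%:R * ((-1) ^+ b * W%:R / 2 ^+ j) : R| <= 1.
  have -> : Y%:R * ((-1) ^+ b * W%:R / 2 ^+ j) = (-1) ^+ b * ((W * Y)%:R / 2 ^+ j) :> R.
    by rewrite natrM; ring.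
  by rewrite sign_dist divn_dist.
move: fx rY hr; rewrite !ler_norml => /andP[? ?] /andP[? ?] /andP[? ?].
by apply/andP; split; lra.
Qed.

Lemma int_approximation : polytime_real1 f -> exists2 h, polytime_int h &
  forall x y : int, 1 <= y -> `|(h x y)%:~R - y%:~R * f (x%:~R / y%:~R)| <= 5 / 2.
Proof.
move=> [M Mf [p Mp]]; have [c cK] := exp2_archi (2 * K).
have [c1 [k1 pE]] := poly2_pbound p.
(* [N] is the total length of the two numerals. The quotient has at most [N + c] digits and the
   precision is at most [N], so [2 * N + c] bounds the sum of the arguments of [p]. *)
pose B N := (N + (c + 1) + c1 * (2 * N + (c + 1)) ^ k1)%N.
pose F N := (150 * 1000 * B N * B N)%N.
have F_pbound : pbound F.
  have BP : pbound B.
    apply: pboundD; first exact: pboundD pbound_id (pbound_const _).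
    apply: pboundM; first exact: pbound_const.
    apply: pboundX; apply: pboundD; last exact: pbound_const.
    exact: pboundM (pbound_const _) pbound_id.
  by apply: pboundM (BP); apply: pboundM (BP); exact: pbound_const.
(* The integer function is whatever the machine prints; its value is estimated only for [y >= 1],
   but it is printed in time for all pairs. *)
have key (x y : int) : exists z : int,
    (forall T, (F (size (enc_int x) + size (enc_int y)) <= T)%N ->
      halted (run (machineB M c) no_oracle (int_input x y) T) /\
      outputs (run (machineB M c) no_oracle (int_input x y) T) (enc_int z)) /\
    (1 <= y -> `|z%:~R - y%:~R * f (x%:~R / y%:~R)| <= 5 / 2).
  have [lx [xE vx lx_gt0]] := enc_int_bval x; have [ly [yE vy ly_gt0]] := enc_int_bval y.
  set xs := rev lx in xE; set ys := rev ly in yE.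
  have xs_gt0 : (0 < size xs)%N by rewrite size_rev.
  have ys_gt0 : (0 < size ys)%N by rewrite size_rev.
  have [q [e [sq qE rB]]] := @runs_programB 0 1 M no_oracle c (x < 0) (y < 0) xs ys
    (reg0 M) xs_gt0 ys_gt0.
  rewrite !revK vx vy in qE rB; set m := (size ys + c)%N in sq qE rB.
  pose qr := dy (x < 0) (bval q) m.
  have xpsi (i : 'I_1) : CF (ratr qr : R) (fun=> qr) by apply: CF_const; exact: dyadic_of_dy.
  have [t [ht [r [dr outr rg]]]] := Mf (fun=> ratr qr) (fun=> fun=> qr) xpsi (size ys).
  have hT := Mp (fun=> ratr qr) (fun=> fun=> qr) xpsi (size ys).
  set t' := p.[_, _] in hT.
  have {ht}outr := outputs_halted ht outr hT.
  have [b [u [v [encE u_gt0 rE _]]]] := decode dr.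
  rewrite encE in outr.
  have [s' [st' [rB' outB]]] := rB (fun=> fun=> qr) t' b u v (fun _ _ => erefl) hT outr u_gt0.
  set z := ((-1) ^+ b * _)%R in outB; exists z; split.
    move=> T le_T; rewrite /int_input xE yE -catA.
    rewrite -initialE in rB'.
    have stO : (st' (inl TOut)).1 = wordf _ (enc_int z) by rewrite outB.
    apply: (run_machine (uniq_tapes _) rB' stO).
    have le_B : (size xs + m + t' + 1 <= B (size (enc_int x) + size (enc_int y)))%N.
      have le_xs : (size xs <= size (enc_int x))%N by rewrite xE size_cat size_bits leq_addl.
      have le_ys : (size ys <= size (enc_int y))%N by rewrite yE size_cat size_bits leq_addl.
      (* Ignoring the denominator is crude but enough: the number of digits of [q] is linear in the
         input length. *)
      have le_q : (magnitude (fun _ : 'I_1 => ratr qr : R) <= size q)%N.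
        apply: magnitude_le => i; rewrite normr_dy.
        rewrite ler_pdivrMr ?exprn_gt0 //; apply: (@le_trans _ _ (2 ^+ size q)).
          by rewrite -natrX ler_nat ltnW // bval_lt.
        by rewrite ler_peMr ?exprn_ge0 // exprn_ege1 // ler1n.
      have : (t' <= c1 * (2 * (size (enc_int x) + size (enc_int y)) + (c + 1)) ^ k1)%N.
        by rewrite addn1 addnS; apply: pE; rewrite sq /m in le_q; lia.
      by rewrite /B /m; lia.
    apply: leq_trans le_T; rewrite /F -!mulnA !leq_mul2l; apply/orP; right.
    by apply/orP; right; exact: leq_mul.
  move=> y_ge1; have y_gt0 : (0 < `|y|)%N by rewrite absz_gt0 gt_eqF // (lt_le_trans ltr01).
  have yR : y%:~R = `|y|%N%:R :> R.
    by rewrite -[in LHS](gez0_abs (le_trans ler01 y_ge1)).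
  have xR : x%:~R = (-1) ^+ (x < 0)%R * `|x|%N%:R :> R.
    by rewrite [in LHS](intEsign x) rmorphM /= rmorph_sign.
  have [E lt_e] := qE y_gt0.
  rewrite yR xR /z rmorphM /= rmorph_sign /=.
  apply: (rounded_product (bx := x < 0) (q := bval q) (e := e) (k := size ys) cK) => //.
    by rewrite -vy ltnW // (leq_trans (bval_lt _)) // size_rev.
  by move: rg; rewrite rE !ratr_dy.
have [h hE] := choice (fun xy : int * int => key xy.1 xy.2).
exists (fun x y => h (x, y)).
  exists (machineB M c) => [x y|].
    by have [hT _] := hE (x, y); exists (F (size (enc_int x) + size (enc_int y))); exact: hT.
  have [p' p'F] := pbound_poly2 F_pbound; exists p' => x y.
  by have [hT _] := hE (x, y); have [] := hT _ (p'F _ _).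
by move=> x y; have [] := hE (x, y).
Qed.

End FromPolytime.

End Main.

Unset Implicit Arguments.
Set Strict Implicit.
Local Open Scope ring_scope.

Theorem theorem12 (R : realType) (C : set (R -> R -> R))
    (C_polytime : C `<=` [set g | polytime_real2 g])
    (C_approx : approximates C [set h | polytime_int h])
    (f : R -> R) (f_lipschitz : exists2 K : R, 0 <= K & K.-lipschitz f) :
  polytime_real1 f <-> definable C f.
Proof.
have [K K_ge0 /lipschitzE lipf] := f_lipschitz; split=> [f_poly|[g Cg gf]].
  have [h h_poly hf] := int_approximation K_ge0 lipf f_poly.
  have [g Cg gh] := C_approx h h_poly; exists g => // x y y_ge1.
  (* The errors [5 / 2] and [1 / 4] add up to [11 / 4], which is below the 3 allowed by
     definability. *)
  have := hf x y y_ge1; have := gh x y.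
  rewrite !ler_norml => /andP[? ?] /andP[? ?]; apply/andP; split; lra.
exact: polytime_of_definable K_ge0 lipf gf (C_polytime g Cg).
Qed.
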